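(* Let $p>1$ be a real number and let $\alpha\ge0$ be a real number with $\alpha\ne p-1$. Then for all $u\in H^1_0(\mathbb{N})$, $$\sum_{n=1}^\infty|u_n-u_{n-1}|^p\,n^\alpha\ge\mathcal{A}^{\mathrm{disc}}_{\alpha,p}\sum_{n=1}^\infty|u_n|^p\,n^{\alpha-p},$$ with $\mathcal{A}^{\mathrm{disc}}_{\alpha,p}=\left|\frac{\alpha-p+1}{p}\right|^p=\mathcal{A}^{\mathrm{cont}}_{\alpha,p}$. Furthermore, the constant $\mathcal{A}^{\mathrm{disc}}_{\alpha,p}$ is sharp, i.e. the inequality for all $u\in H_0^1(\mathbb{N})$ fails if $\mathcal{A}^{\mathrm{disc}}_{\alpha,p}$ is replaced by any larger constant.
   Context: $H^1_0(\mathbb{N})$ denotes the space of finitely supported real sequences $u=(u_n)_{n\ge0}$ with $u_0=0$. For $\alpha\neq p-1$, $\mathcal{A}^{\mathrm{cont}}_{\alpha,p}$ is the sharp (largest) constant in the continuous Hardy inequality $\int_0^\infty|\varphi'(x)|^p x^\alpha\,dx\ge\mathcal{A}^{\mathrm{cont}}_{\alpha,p}\int_0^\infty|\varphi(x)|^p x^{\alpha-p}\,dx$ for all $\varphi\in C_0^\infty(0,\infty)$; its value is known to be $\left|\frac{\alpha+1-p}{p}\right|^p$. *)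

(* Defs.v *)
From HB Require Import structures.
From mathcomp Require Import all_boot all_order all_algebra.
From mathcomp Require Import all_classical all_reals all_analysis.

Set Implicit Arguments.
Unset Strict Implicit.
Unset Printing Implicit Defensive.

Import Order.TTheory GRing.Theory Num.Theory.
Import numFieldNormedType.Exports.

Local Open Scope classical_set_scope.
Local Open Scope ring_scope.

Definition H10 (R : realType) : set (nat -> R) :=
  [set u | u 0%N = 0 /\ finite_set [set n | u n != 0]].

(* A function of C_0^oo(0, +oo) is identified with its extension by 0 to the
   whole real line, which is smooth on R. *)
Definition test_function (R : realType) : set (R -> R) :=
  [set phi | [/\ forall (n : nat) (x : R), derivable (derive1n n phi) x 1,
                 compact (closure [set x | phi x != 0]) &
                 closure [set x | phi x != 0] `<=` `]0, +oo[ ] ].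

(* All sums and integrals below have nonnegative terms, so they are well
   defined in \bar R. The base of every power is nonnegative, and
   0 `^ p = 0 since p > 1. *)

Definition discrete_hardy (R : realType) (alpha p C : R) : Prop :=
  forall u : nat -> R, H10 u ->
    (\sum_(1 <= n <oo) (`|u n - u n.-1| `^ p * n%:R `^ alpha)%:E >=
     C%:E * \sum_(1 <= n <oo) (`|u n| `^ p * n%:R `^ (alpha - p))%:E)%E.

Definition continuous_hardy (R : realType) (alpha p C : R) : Prop :=
  forall phi : R -> R, test_function phi ->
    (\int[lebesgue_measure]_(x in `]0%R, +oo[) (`|derive1 phi x| `^ p * x `^ alpha)%:E >=
     C%:E * \int[lebesgue_measure]_(x in `]0%R, +oo[)
              (`|phi x| `^ p * x `^ (alpha - p))%:E)%E.

Definition largest (R : realType) (S : set R) (C : R) : Prop :=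
  S C /\ ubound S C.

(* Main.v *)
(** Write g = alpha - p + 1 and B = |g| / p, so that Adisc = B^p. Both
    inequalities come from Young's inequality
    x^p + (p-1) (B y)^p >= p x (B y)^(p-1), with x^p the gradient term and y^p
    the potential term, which leaves a cross term |u'| |u|^(p-1) x^g.
    In the continuous case this dominates B times the potential term up to the
    total derivative of |u|^p x^g / p (with a sign). In the discrete case the same
    is achieved by a telescoping sum, chosen according to whether alpha < p - 1
    (a second Young inequality for u_n / n^s with s = 1 - alpha / (p - 1)),
    p - 1 < alpha <= p (convexity of |.|^p), or alpha >= p (a second Young
    inequality for u_n n^(alpha / p - 1)).

    For sharpness take phi(x) = x^(-g/p) eta(ln x / L) with eta a smooth bump
    supported in [0, 1]. Then |phi'|^p x^alpha <= (Adisc eta^p + O(1/L)) / x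
    whereas |phi|^p x^(alpha-p) = eta^p / x, and the integral of eta^p / x
    grows linearly in L. The same function restricted to the integers serves
    the discrete inequality. *)

Require Import Defs.
From HB Require Import structures.
From mathcomp Require Import all_boot all_order all_algebra.
From mathcomp Require Import all_classical all_reals all_analysis.
From mathcomp Require Import ring lra.

Set Implicit Arguments.
Unset Strict Implicit.
Unset Printing Implicit Defensive.

Import Order.TTheory GRing.Theory Num.Theory.
Import numFieldNormedType.Exports.

Local Open Scope classical_set_scope.
Local Open Scope ring_scope.

(** * Young's inequality for real powers and its consequences *)

(** Young's inequality for the conjugate exponents p and p / (p - 1), applied to x and y^(p-1) and
    multiplied by p. *)
Lemma young_powR (R : realType) (p x y : R) : 1 < p -> 0 <= x -> 0 <= y ->
  p * (x * y `^ (p - 1)) <= x `^ p + (p - 1) * y `^ p.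
Proof.
move=> p1 x0 y0.
have p0 : 0 < p by apply: lt_trans p1.
have q0 : 0 < p - 1 by rewrite subr_gt0.
have e1 : (p - 1) * (p / (p - 1)) = p by field; rewrite gt_eqF.
have e2 : p^-1 + (p / (p - 1))^-1 = 1 by field; rewrite !gt_eqF.
have := conjugate_powR x0 (powR_ge0 y (p - 1)) p0 (divr_gt0 p0 q0) e2.
rewrite -powRrM e1 -(ler_pM2l p0) => /le_trans; apply.
by rewrite le_eqVlt; apply/orP; left; apply/eqP; field; rewrite !gt_eqF.
Qed.

(** Convexity of t^p: the tangent at y lies below the graph at x. This is [young_powR] rearranged by
    means of y^p = y y^(p-1). *)
Lemma powR_tangent (R : realType) (p x y : R) : 1 < p -> 0 <= x -> 0 <= y ->
  y `^ p - x `^ p <= p * (y `^ (p - 1) * (y - x)).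
Proof.
move=> p1 x0 y0; have := young_powR p1 x0 y0.
have p0 : 0 < p by apply: lt_trans p1.
rewrite -(mulr_powRB1 y0 p0); nra.
Qed.

Lemma bernoulli_powR (R : realType) (q t : R) : 1 <= q -> 0 <= t ->
  1 + q * t <= (1 + t) `^ q.
Proof.
move=> + t0; rewrite le_eqVlt => /predU1P[<-|q1].
  by rewrite powRr1 ?mul1r// addr_ge0.
have := young_powR q1 (addr_ge0 ler01 t0) ler01.
by rewrite !powR1 /=; lra.
Qed.

(** Concavity of t^s. For s < 1 it follows from Young's inequality with exponent 1/s for (n-1)^s and
    n^s, after multiplication by s n^(s-1). *)
Lemma powR_concave_diff (R : realType) (s n : R) : 0 < s -> s <= 1 -> 1 <= n ->
  s * n `^ (s - 1) <= n `^ s - (n - 1) `^ s.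
Proof.
move=> s0 s1 n1.
have n0 : 0 < n by apply: lt_le_trans n1.
have m0 : 0 <= n - 1 by rewrite subr_ge0.
have [->|sn1] := eqVneq s 1; first by rewrite subrr powRr0 !powRr1 ?(ltW n0)//; lra.
have p1 : 1 < s^-1 by rewrite invf_gt1// lt_neqAle sn1.
have := young_powR p1 (powR_ge0 (n - 1) s) (powR_ge0 n s).
rewrite -!powRrM divff ?gt_eqF// !powRr1 ?(ltW n0)//.
have -> : s * (s^-1 - 1) = 1 - s by field; rewrite gt_eqF.
rewrite -(ler_pM2l s0) -(ler_pM2r (powR_gt0 (s - 1) n0)).
have -> : n `^ s = n `^ (s - 1) * n by rewrite mulrC mulr_powRB1 // ltW.
have e : n `^ (1 - s) * n `^ (s - 1) = 1.
  by rewrite -powRD ?(gt_eqF n0) ?implybT// subrKA subrr powRr0.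
have sV : s * s^-1 = 1 by rewrite divff ?gt_eqF.
rewrite !mulrA sV mul1r -mulrA e mulr1 mulrDr mulrBr mulrA mulrBr sV; nra.
Qed.

(** * The discrete inequality *)

Lemma gt0_powRD (R : realType) (x r s : R) : 0 < x ->
  x `^ (r + s) = x `^ r * x `^ s.
Proof. by move=> x0; rewrite powRD// (gt_eqF x0) implybT. Qed.

(** The weight is distributed by taking x = d n^(alpha/p) and y = B U n^(alpha/p - 1) in Young's
    inequality: x^p is the gradient term, y^p is B^p times the potential term, and the powers of n
    in the cross term add up to alpha - p + 1. *)
Lemma hardy_young (R : realType) (alpha p B n d U : R) : 1 < p -> 0 <= B ->
  0 < n -> 0 <= d -> 0 <= U ->
  p * B `^ (p - 1) * (d * U `^ (p - 1) * n `^ (alpha - p + 1)) <=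
  d `^ p * n `^ alpha + (p - 1) * (B `^ p * (U `^ p * n `^ (alpha - p))).
Proof.
move=> p1 B0 n0 d0 U0.
have p0 : 0 < p by apply: lt_trans p1.
have pE : p != 0 by rewrite gt_eqF.
have := young_powR p1 (mulr_ge0 d0 (powR_ge0 n (alpha / p)))
  (mulr_ge0 B0 (mulr_ge0 U0 (powR_ge0 n (alpha / p - 1)))).
rewrite !powRM ?mulr_ge0 ?powR_ge0// -!powRrM divfK// => h.
have e1 : (alpha / p - 1) * p = alpha - p by field.
rewrite e1 in h; apply: le_trans h; rewrite le_eqVlt; apply/orP; left; apply/eqP.
have -> : alpha - p + 1 = alpha / p + (alpha / p - 1) * (p - 1) by field.
by rewrite (gt0_powRD _ _ n0); ring.
Qed.

(* In the next three lemmas [U], [V] and [d] stand for |u_n|, its neighbour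
   |u_(n-1)| or |u_(n+1)|, and the corresponding difference; the bracket
   multiplied by [B `^ (p - 1)] telescopes. *)
Lemma hardy_step_lt (R : realType) (alpha p B g n d U V : R) : 1 < p -> 0 <= alpha ->
  alpha < p - 1 -> 1 <= n -> 0 <= d -> 0 <= U -> 0 <= V -> U - V <= d ->
  (n = 1 -> V = 0) ->
  B = (p - 1 - alpha) / p -> g = alpha - p + 1 ->
  B `^ p * (U `^ p * n `^ (alpha - p)) +
    B `^ (p - 1) * (n `^ g * U `^ p - (n - 1) `^ g * V `^ p) <=
  d `^ p * n `^ alpha.
Proof.
move=> p1 a0 ap n1 d0 U0 V0 UVd V1 BE gE.
have p0 : 0 < p by apply: lt_trans p1.
have pE : p != 0 by rewrite gt_eqF.
have n0 : 0 < n by apply: lt_le_trans n1.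
have B0 : 0 < B by rewrite BE divr_gt0// subr_gt0.
have pB : p * B = p - 1 - alpha by rewrite BE mulrC divfK.
have := hardy_young alpha p1 (ltW B0) n0 d0 U0; rewrite -gE.
have : p * B * (n `^ (alpha - p) * U `^ p) + n `^ g * U `^ p - (n - 1) `^ g * V `^ p
  <= p * (d * U `^ (p - 1) * n `^ g).
  apply: (@le_trans _ _ (p * ((U - V) * U `^ (p - 1) * n `^ g))); last first.
    by rewrite ler_pM2l// !ler_wpM2r ?powR_ge0.
  (* At n = 1 the power (n-1)^g has base 0, but V = 0 removes its term; what remains is (p - alpha)
     U^p <= p U^p. *)
  have [n1E|n1E] := eqVneq n 1.
    rewrite (V1 n1E) n1E powR0// !powR1 pB subr0 (mulr_powRB1 U0 p0).
    by have := powR_ge0 U p; nra.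
  have m0 : 0 < n - 1 by rewrite subr_gt0 lt_neqAle eq_sym n1E.
  (* The function v = x^s solves (x^alpha |v'|^(p-2) v')' = 0, which suggests applying Young's
     inequality to V / (n-1)^s and U / n^s. The identities -s (p-1) = g and (p-1) s = p B then
     produce the telescoping bracket. *)
  pose s := 1 - alpha / (p - 1).
  have q0 : 0 < p - 1 by rewrite subr_gt0.
  have qE : p - 1 != 0 by rewrite gt_eqF.
  have s0 : 0 < s by rewrite subr_gt0 ltr_pdivrMr// mul1r.
  have s1 : s <= 1 by rewrite gerBl divr_ge0// ltW.
  have := powR_concave_diff s0 s1 n1.
  have := young_powR p1 (mulr_ge0 V0 (powR_ge0 (n - 1) (- s)))
    (mulr_ge0 U0 (powR_ge0 n (- s))).
  rewrite !powRM ?powR_ge0// -!powRrM -(ler_pM2r (powR_gt0 s m0)).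
  have eg : - s * (p - 1) = g by rewrite /s gE; field.
  have e1 : (n - 1) `^ (- s) * (n - 1) `^ s = 1 by rewrite -gt0_powRD// addNr powRr0.
  have e2 : (n - 1) `^ (- s * p) * (n - 1) `^ s = (n - 1) `^ g.
    by rewrite -gt0_powRD// -eg; congr (_ `^ _); ring.
  have e3 : n `^ (- s * p) * n `^ s = n `^ g.
    by rewrite -gt0_powRD// -eg; congr (_ `^ _); ring.
  have e4 : n `^ (- s * p) * n `^ (s - 1) = n `^ (alpha - p).
    rewrite -gt0_powRD//; congr (_ `^ _).
    by transitivity (- s * (p - 1) - 1); [ring|rewrite eg gE; ring].
  have es : (p - 1) * s = p * B by rewrite pB /s; field.
  rewrite eg => hY hC.
  have {}hC : (p - 1) * U `^ p * n `^ (- s * p) * (s * n `^ (s - 1)) <=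
      (p - 1) * U `^ p * n `^ (- s * p) * (n `^ s - (n - 1) `^ s).
    by rewrite ler_wpM2l// !mulr_ge0 ?powR_ge0// ltW.
  have hC' : p * B * (n `^ (alpha - p) * U `^ p) <= (p - 1) * U `^ p * n `^ g -
      (p - 1) * U `^ p * n `^ (- s * p) * (n - 1) `^ s.
    by rewrite -es -e4 -e3; move: hC; lra.
  have hY' : p * (V * U `^ (p - 1) * n `^ g) <= V `^ p * (n - 1) `^ g +
     (p - 1) * U `^ p * n `^ (- s * p) * (n - 1) `^ s.
    rewrite -e2; apply: le_trans (le_trans hY _); last by rewrite le_eqVlt; apply/orP; left; apply/eqP; ring.
    rewrite le_eqVlt; apply/orP; left; apply/eqP.
    transitivity (p * (V * U `^ (p - 1) * n `^ g) * ((n - 1) `^ (- s) * (n - 1) `^ s)).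
      by rewrite e1 mulr1.
    ring.
  have -> : p * ((U - V) * U `^ (p - 1) * n `^ g) =
      p * U `^ p * n `^ g - p * (V * U `^ (p - 1) * n `^ g).
    by rewrite -(mulr_powRB1 U0 p0); ring.
  by lra.
rewrite -(ler_pM2l (powR_gt0 (p - 1) B0)) -(mulr_powRB1 (ltW B0) p0); lra.
Qed.

Lemma hardy_step_le (R : realType) (alpha p g B n d U V : R) : 1 < p -> 0 <= alpha ->
  p - 1 < alpha -> alpha <= p -> 1 <= n -> 0 <= d -> 0 <= U -> 0 <= V -> U - V <= d ->
  g = alpha - p + 1 -> B = g / p ->
  B `^ p * (U `^ p * n `^ (alpha - p)) +
    B `^ (p - 1) * ((n - 1) `^ g * U `^ p - n `^ g * V `^ p) <=
  d `^ p * (n + 1) `^ alpha.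
Proof.
move=> p1 a0 ap pa n1 d0 U0 V0 UVd gE BE.
have p0 : 0 < p by apply: lt_trans p1.
have n0 : 0 < n by apply: lt_le_trans n1.
have g0 : 0 < g by rewrite gE; lra.
have g1 : g <= 1 by rewrite gE; lra.
have B0 : 0 < B by rewrite BE divr_gt0.
have pB : p * B = g by rewrite BE mulrC divfK// gt_eqF.
have := hardy_young alpha p1 (ltW B0) n0 d0 U0; rewrite -gE.
(* The difference between n and n + 1 carries the weight (n+1)^alpha, of which only n^alpha is
   kept. *)
have hn : d `^ p * n `^ alpha <= d `^ p * (n + 1) `^ alpha.
  by rewrite ler_wpM2l ?powR_ge0// ge0_ler_powR ?nnegrE//; lra.
have := powR_concave_diff g0 g1 n1.
rewrite (_ : g - 1 = alpha - p); last by rewrite gE; ring.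
have hU : U `^ p - V `^ p <= p * (d * U `^ (p - 1)).
  apply: (le_trans (powR_tangent p1 V0 U0)); rewrite ler_pM2l// mulrC.
  by rewrite ler_wpM2r ?powR_ge0.
have hU' : n `^ g * (U `^ p - V `^ p) <= n `^ g * (p * (d * U `^ (p - 1))).
  by rewrite ler_wpM2l ?powR_ge0.
move=> hC hY; apply: le_trans hn.
have hC' : g * (n `^ (alpha - p) * U `^ p) <= (n `^ g - (n - 1) `^ g) * U `^ p.
  by rewrite mulrA ler_wpM2r ?powR_ge0.
(* By [hC'] the left side is at most n^g (U^p - V^p), which [hU'] bounds by the cross term. *)
have : g * (n `^ (alpha - p) * U `^ p) + ((n - 1) `^ g * U `^ p - n `^ g * V `^ p) <=
    p * (d * U `^ (p - 1) * n `^ g) by lra.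
rewrite -{1}pB -(ler_pM2l (powR_gt0 (p - 1) B0)).
move: hY; rewrite -(mulr_powRB1 (ltW B0) p0); lra.
Qed.

Lemma hardy_step_ge (R : realType) (alpha p B n d U V : R) : 1 < p ->
  p <= alpha -> 1 <= n -> 0 <= d -> 0 <= U -> 0 <= V -> U - V <= d ->
  B = (alpha - p + 1) / p ->
  B `^ p * (U `^ p * n `^ (alpha - p)) +
    B `^ (p - 1) * (n * (U `^ p * n `^ (alpha - p)) -
                    (n + 1) * (V `^ p * (n + 1) `^ (alpha - p))) <=
  d `^ p * (n + 1) `^ alpha.
Proof.
move=> p1 pa n1 d0 U0 V0 UVd BE.
have p0 : 0 < p by apply: lt_trans p1.
have pE : p != 0 by rewrite gt_eqF.
have n0 : 0 < n by apply: lt_le_trans n1.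
have m0 : 0 < n + 1 by rewrite addr_gt0.
have B0 : 0 < B by rewrite BE divr_gt0//; lra.
have pB : p * B = alpha - p + 1 by rewrite BE mulrC divfK.
pose q := alpha / p.
have q1 : 1 <= q by rewrite ler_pdivlMr// mul1r.
(* The weights are absorbed into the unknown: w^p and w'^p are the potential terms at n and n +
   1. *)
pose w := U * n `^ (q - 1); pose w' := V * (n + 1) `^ (q - 1).
have w0 : 0 <= w by rewrite mulr_ge0 ?powR_ge0.
have w'0 : 0 <= w' by rewrite mulr_ge0 ?powR_ge0.
have eq1 : (q - 1) * p = alpha - p by rewrite /q; field.
have eq2 : q * p = alpha by rewrite /q; field.
have -> : U `^ p * n `^ (alpha - p) = w `^ p.
  by rewrite powRM ?powR_ge0// -powRrM eq1.
have -> : V `^ p * (n + 1) `^ (alpha - p) = w' `^ p.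
  by rewrite powRM ?powR_ge0// -powRrM eq1.
have -> : d `^ p * (n + 1) `^ alpha = (d * (n + 1) `^ q) `^ p.
  by rewrite powRM ?powR_ge0// -powRrM eq2.
have mq : (n + 1) `^ q = (n + 1) * (n + 1) `^ (q - 1).
  by rewrite mulr_powRB1// ?ltW//; lra.
(* Bernoulli's inequality for (1 + 1/n)^q gives (n + q) n^(q-1) <= (n+1)^q. The surplus q is the
   source of B, since p q = p B + p - 1. *)
have hx : (n + q) * w - (n + 1) * w' <= d * (n + 1) `^ q.
  apply: (@le_trans _ _ ((U - V) * (n + 1) `^ q)); last by rewrite ler_wpM2r ?powR_ge0.
  have : (n + q) * w <= U * (n + 1) `^ q.
    rewrite /w mulrCA ler_wpM2l//.
    have hB := bernoulli_powR q1 (ltW (divr_gt0 ltr01 n0)).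
    have : (1 + q * (1 / n)) * n `^ q <= (1 + 1 / n) `^ q * n `^ q.
      by rewrite ler_wpM2r ?powR_ge0.
    rewrite -powRM ?(ltW n0) ?addr_ge0 ?divr_ge0 ?(ltW n0)//.
    have -> : (1 + 1 / n) * n = n + 1 by field; rewrite gt_eqF.
    apply: le_trans; rewrite -(@mulr_powRB1 _ n q) ?(ltW n0)//; last by lra.
    by rewrite le_eqVlt; apply/orP; left; apply/eqP; field; rewrite gt_eqF.
  have -> : (n + 1) * w' = V * (n + 1) `^ q by rewrite mq /w'; ring.
  by rewrite mulrBl; lra.
have := young_powR p1 (mulr_ge0 d0 (powR_ge0 (n + 1) q)) (mulr_ge0 (ltW B0) w0).
rewrite !(powRM _ (ltW B0) w0); set x := d * _ in hx *.
have hw' := young_powR p1 w'0 w0.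
have {}hx : p * (((n + q) * w - (n + 1) * w') * w `^ (p - 1)) <= p * (x * w `^ (p - 1)).
  by rewrite ler_pM2l// ler_wpM2r ?powR_ge0.
have {}hw' : (n + 1) * (p * (w' * w `^ (p - 1))) <= (n + 1) * (w' `^ p + (p - 1) * w `^ p).
  by rewrite ler_pM2l.
have pq : p * q = p * B + p - 1 by rewrite pB mulrC eq2; ring.
have : p * B * w `^ p + (n * w `^ p - (n + 1) * w' `^ p) <= p * (x * w `^ (p - 1)).
  apply: le_trans hx.
  have -> : p * (((n + q) * w - (n + 1) * w') * w `^ (p - 1)) =
    (p * n + p * q) * (w * w `^ (p - 1)) - (n + 1) * (p * (w' * w `^ (p - 1))) by ring.
  rewrite pq (mulr_powRB1 w0 p0); move: hw'.
  by move: (w `^ p) (w' `^ p) (w' * _) => X Y Z; clear; lra.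
clear hx hw'; rewrite -(ler_pM2l (powR_gt0 (p - 1) B0)) -(mulr_powRB1 (ltW B0) p0).
move: (B `^ _) (w `^ p) (w' `^ p) (w `^ (p - 1)) (x `^ p) => Q W W' Z X.
by clear; lra.
Qed.

Lemma discrete_hardy_sum (R : realType) (p alpha : R) (u : nat -> R) (M : nat) :
  1 < p -> 0 <= alpha -> alpha != p - 1 -> u 0%N = 0 -> u M.+1 = 0 ->
  `|(alpha - p + 1) / p| `^ p *
    (\sum_(1 <= n < M.+2) `|u n| `^ p * n%:R `^ (alpha - p)) <=
  \sum_(1 <= n < M.+2) `|u n - u n.-1| `^ p * n%:R `^ alpha.
Proof.
move=> p1 a0 ne u0 uM.
have p0 : 0 < p by apply: lt_trans p1.
have pE : p != 0 by rewrite gt_eqF.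
have n1 i : (1 : R) <= i.+1%:R by rewrite ler1n.
have nB i : i.+1%:R - 1 = i%:R :> R by rewrite -natr1 addrK.
set A := _ `^ p.
have [ap|pa] := ltP alpha (p - 1).
  have AE : A = ((p - 1 - alpha) / p) `^ p.
    rewrite /A -normrN -mulNr ger0_norm ?divr_ge0 ?(ltW p0)//; last by lra.
    by congr (_ `^ _); field.
  (* For alpha < p - 1 each potential term is paired with the gradient term of the same index. The
     telescoping sum starts at 0 because u_0 = 0 and ends at a nonnegative value. *)
  pose z n := n%:R `^ (alpha - p + 1) * `|u n| `^ p.
  have z0 : z 0%N = 0 by rewrite /z u0 normr0 (powR0 pE) mulr0.
  apply: (@le_trans _ _ (A * (\sum_(1 <= n < M.+2) `|u n| `^ p * n%:R `^ (alpha - p)) +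
     ((p - 1 - alpha) / p) `^ (p - 1) * \sum_(0 <= n < M.+1) (z n.+1 - z n))).
    rewrite telescope_sumr// z0 subr0 lerDl mulr_ge0 ?powR_ge0// mulr_ge0 ?powR_ge0//.
  rewrite !big_add1 /= !mulr_sumr -big_split/= ler_sum// => i _.
  have := hardy_step_lt p1 a0 ap (n1 i) (normr_ge0 (u i.+1 - u i)) (normr_ge0 (u i.+1))
    (normr_ge0 (u i)) (lerB_dist _ _) _ erefl erefl.
  rewrite -AE nB; apply => h.
  have -> : i = 0%N by move/eqP: h; rewrite pnatr_eq1 eqSS => /eqP.
  by rewrite u0 normr0.
have {ne}pa : p - 1 < alpha by rewrite lt_neqAle eq_sym ne.
have AE : A = ((alpha - p + 1) / p) `^ p.
  by rewrite /A ger0_norm ?divr_ge0 ?(ltW p0)//; lra.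
rewrite big_nat_recr//= uM normr0 (powR0 pE) mul0r addr0 big_add1/=.
rewrite [leRHS]big_nat_recl//=.
(* For alpha > p - 1 the potential term at n is paired with the gradient term at n + 1, so the
   gradient term at 1 is left over and dropped. The telescoping sum now ends at 0 because u_(M+1) =
   0. *)
have step z : 0 <= z 0%N -> z M = 0 ->
  (forall i : nat, A * (`|u i.+1| `^ p * i.+1%:R `^ (alpha - p)) +
    ((alpha - p + 1) / p) `^ (p - 1) * (z i - z i.+1) <=
    `|u i.+2 - u i.+1| `^ p * i.+2%:R `^ alpha) ->
  A * (\sum_(0 <= i < M) `|u i.+1| `^ p * i.+1%:R `^ (alpha - p)) <=
  `|u 1%N - u 0%N| `^ p * 1 `^ alpha +
     \sum_(1 <= i < M.+1) `|u i.+1 - u i| `^ p * i.+1%:R `^ alpha.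
  move=> z0 zM zi; apply: ler_wpDl; first by rewrite mulr_ge0 ?powR_ge0.
  apply: (@le_trans _ _ (A * (\sum_(0 <= i < M) `|u i.+1| `^ p * i.+1%:R `^ (alpha - p)) +
    ((alpha - p + 1) / p) `^ (p - 1) * \sum_(0 <= i < M) (z i - z i.+1))).
    rewrite lerDl mulr_ge0 ?powR_ge0//.
    rewrite (eq_bigr (fun i => (- z i.+1) - (- z i))); last first.
      by move=> i _; rewrite opprK addrC.
    by rewrite (telescope_sumr (fun i => - z i))// zM oppr0 sub0r opprK.
  by rewrite big_add1 /= !mulr_sumr -big_split/= ler_sum.
have UV i : `|u i.+1| - `|u i.+2| <= `|u i.+2 - u i.+1| by rewrite distrC lerB_dist.
have [lap|lpa] := leP alpha p.
  apply: (step (fun i => i%:R `^ (alpha - p + 1) * `|u i.+1| `^ p)).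
  - by rewrite mulr_ge0 ?powR_ge0.
  - by rewrite uM normr0 (powR0 pE) mulr0.
  - move=> i; rewrite AE; have := hardy_step_le p1 a0 pa lap (n1 i) (normr_ge0 _)
      (normr_ge0 _) (normr_ge0 _) (UV i) erefl erefl.
    by rewrite natr1 nB.
apply: (step (fun i => i.+1%:R * (`|u i.+1| `^ p * i.+1%:R `^ (alpha - p)))).
- by rewrite mul1r mulr_ge0 ?powR_ge0.
- by rewrite uM normr0 (powR0 pE) mul0r mulr0.
- move=> i; rewrite AE; have := hardy_step_ge p1 (ltW lpa) (n1 i) (normr_ge0 _)
    (normr_ge0 _) (normr_ge0 _) (UV i) erefl.
  by rewrite natr1.
Qed.

Lemma eseries_finite_support (R : realType) (f : nat -> R) (N : nat) :
  (forall n, (N <= n)%N -> f n = 0) ->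
  (\sum_(1 <= n <oo) (f n)%:E = (\sum_(1 <= n < N) f n)%:E)%E.
Proof.
move=> f0; apply: lim_near_cst => //; exists N => // n /= Nn.
rewrite sumEFin; congr EFin.
have [N0|N1] := leqP N 1%N.
  rewrite !big_seq !big1// => i; rewrite mem_index_iota => /andP[i1 iN].
    by rewrite f0// (leq_trans _ i1).
  by rewrite f0// (leq_trans N0).
rewrite (big_cat_nat (ltnW N1) Nn)/= [X in _ + X]big_nat_cond [X in _ + X]big1 ?addr0//.
by move=> i /andP[/andP[Ni _] _]; exact: f0.
Qed.

Lemma discrete_hardy_Adisc (R : realType) (p alpha : R) : 1 < p -> 0 <= alpha ->
  alpha != p - 1 -> discrete_hardy alpha p (`|(alpha - p + 1) / p| `^ p).
Proof.
move=> p1 a0 ne u [u0 /finite_seqP[s us]].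
have pE : p != 0 by rewrite gt_eqF// (lt_trans _ p1).
have uM n : (\max_(i <- s) i < n)%N -> u n = 0.
  move=> mn; apply/eqP; apply: contraTT mn => un; rewrite -leqNgt.
  have ns : n \in s by have : [set` s] n by rewrite -us.
  exact: (@leq_bigmax_seq _ s (fun=> true) id).
set m := (\max_(i <- s) i)%N in uM.
(* The gradient term at m + 1, where u drops from u_m to 0, may be nonzero, so both sums are cut
   only at m + 2. *)
rewrite (@eseries_finite_support _ _ m.+2); last first.
  by move=> n mn; rewrite (uM n) ?normr0 ?powR0 ?mul0r//; exact: ltn_trans mn.
rewrite (@eseries_finite_support _ _ m.+2); last first.
  move=> [|n] mn; first by [].
  by rewrite !(uM _) ?subr0 ?normr0 ?powR0 ?mul0r//; exact: ltn_trans mn.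
rewrite -EFinM lee_fin; apply: discrete_hardy_sum => //.
by rewrite uM.
Qed.

(** * The continuous inequality *)

Lemma is_derive_continuous (R : realType) (f : R -> R) (x df : R) :
  is_derive x 1 f df -> {for x, continuous f}.
Proof.
by move=> [dfx _]; apply: differentiable_continuous; exact/derivable1_diffP.
Qed.

Lemma continuous_norm_powR (R : realType) (r : R) : 0 < r ->
  continuous (fun t : R => `|t| `^ r).
Proof.
move=> r0 t; have [->|t0] := eqVneq t 0.
  rewrite /continuous_at normr0 powR0 ?gt_eqF//.
  apply/cvgr0Pnorm_lt => e e0; near=> h.
  rewrite ger0_norm ?powR_ge0//.
  have <- : (e `^ r^-1) `^ r = e by rewrite -powRrM mulVf ?gt_eqF// powRr1// ltW.
  rewrite gt0_ltr_powR ?nnegrE ?powR_ge0//.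
  by near: h; apply: (@nbhs0_lt R R); rewrite powR_gt0.
have := @continuous_comp R R R (fun t : R => `|t|) (fun a : R => a `^ r) t.
apply; first exact: norm_continuous.
by apply: is_derive_continuous; apply: is_derive1_powR; rewrite normr_gt0.
Unshelve. all: by end_near. Qed.

(** Supplies the derivative at 0 of |t|^p and of the functions built from exp(-1/t), where the
    product and chain rules do not apply. *)
Lemma is_derive_flat (R : realType) (f : R -> R) (x K r : R) : 0 < r ->
  (forall h, `|f (h + x) - f x| <= K * `|h| `^ (1 + r)) -> is_derive x 1 f 0.
Proof.
move=> r0 fK.
suff cv : (fun h : R => h^-1 *: (f (h *: 1 + x) - f x)) @ 0^' --> (0 : R).
  by split; [exact: cvgP cv|exact: cvg_lim cv].
apply/norm_cvg0P.
apply: (@squeeze_cvgr _ _ _ _ (fun=> 0) (fun h => K * `|h| `^ r)).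
- near=> h; rewrite normr_ge0/= normrZ normfV.
  have h0 : 0 < `|h| by rewrite normr_gt0; near: h; exact: nbhs_dnbhs_neq.
  rewrite ler_pdivrMl// [h *: 1]mulr1 (le_trans (fK h))//.
  by rewrite gt0_powRD// powRr1// mulrCA.
- exact: cvg_cst.
- have := @continuous_norm_powR R r r0 0.
  rewrite /continuous_at normr0 powR0 ?gt_eqF// => c.
  have := cvgMl_tmp (a := K) c.
  rewrite mulr0 => c0 U /c0 U0; exact: nbhs_dnbhs.
Unshelve. all: by end_near. Qed.

(* The positive and negative parts of [t] make the derivative
   [p * sg t * |t| ^ (p - 1)] visibly continuous at 0. *)
Definition dnorm_powR (R : realType) (p t : R) : R :=
  p * (`|(`|t| + t) / 2| `^ (p - 1) - `|(`|t| - t) / 2| `^ (p - 1)).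

Lemma continuous_dnorm_powR (R : realType) (p : R) : 1 < p ->
  continuous (dnorm_powR p).
Proof.
move=> p1 t; have r0 : 0 < p - 1 by rewrite subr_gt0.
apply: cvgMl_tmp; apply: cvgB.
- apply: (@continuous_comp R R R (fun t : R => (`|t| + t) / 2) (fun t => `|t| `^ (p - 1))).
    by apply: cvgMr_tmp; apply: cvgD; [exact: norm_continuous|exact: cvg_id].
  exact: continuous_norm_powR.
- have := @continuous_comp R R R (fun t : R => (`|t| - t) / 2) (fun t => `|t| `^ (p - 1)) t.
  apply.
    by apply: cvgMr_tmp; apply: cvgB; [exact: norm_continuous|exact: cvg_id].
  exact: continuous_norm_powR.
Qed.

Lemma dnorm_powR_gt0 (R : realType) (p t : R) : 1 < p -> 0 < t ->
  dnorm_powR p t = p * t `^ (p - 1).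
Proof.
move=> p1 t0; rewrite /dnorm_powR (gtr0_norm t0) subrr mul0r normr0.
rewrite powR0 ?subr0 ?subr_eq0 ?gt_eqF//.
by rewrite (_ : (t + t) / 2 = t) ?gtr0_norm//; field.
Qed.

Lemma dnorm_powRN (R : realType) (p t : R) : dnorm_powR p (- t) = - dnorm_powR p t.
Proof. by rewrite /dnorm_powR normrN opprK -mulrN opprB. Qed.

Lemma dnorm_powR_norm (R : realType) (p t : R) : 1 < p ->
  `|dnorm_powR p t| = p * `|t| `^ (p - 1).
Proof.
move=> p1; have p0 : 0 < p by apply: lt_trans p1.
have [t0|t0|->] := ltgtP t 0.
- rewrite -normrN -dnorm_powRN dnorm_powR_gt0 ?oppr_gt0//.
  by rewrite (ltr0_norm t0) ger0_norm// mulr_ge0 ?powR_ge0 ?ltW.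
- by rewrite dnorm_powR_gt0// (gtr0_norm t0) ger0_norm// mulr_ge0 ?powR_ge0 ?ltW.
- by rewrite /dnorm_powR addr0 subr0 normr0 mul0r subrr mulr0 normr0 powR0 ?mulr0// subr_eq0 gt_eqF.
Qed.

Lemma is_derive_norm_powR (R : realType) (p t : R) : 1 < p ->
  is_derive t 1 (fun t : R => `|t| `^ p) (dnorm_powR p t).
Proof.
move=> p1; have p0 : 0 < p by apply: lt_trans p1.
have [t0|t0|->] := ltgtP t 0.
- apply: (@near_eq_is_derive _ _ _ ((fun a : R => a `^ p) \o -%R)).
    by near=> s; rewrite /= ltr0_norm//; near: s; exact: lt_nbhsl.
  have nt0 : 0 < - t by rewrite oppr_gt0.
  apply: (is_derive_eq (@is_derive1_comp _ (fun a : R => a `^ p) -%R t _ _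
    (is_derive1_powR p nt0) (is_deriveNid _ _))).
  by rewrite mulrN1 -dnorm_powR_gt0// dnorm_powRN opprK.
- apply: (@near_eq_is_derive _ _ _ (fun a : R => a `^ p)).
    by near=> s; rewrite /= gtr0_norm//; near: s; exact: lt_nbhsr.
  by rewrite dnorm_powR_gt0//; exact: is_derive1_powR.
- have -> : dnorm_powR p 0 = 0 by apply/normr0_eq0; rewrite dnorm_powR_norm// normr0 powR0 ?mulr0// subr_eq0 gt_eqF.
  apply: (@is_derive_flat _ _ _ 1 (p - 1)); first by rewrite subr_gt0.
  move=> h; rewrite addr0 normr0 (powR0 (lt0r_neq0 p0)) subr0 mul1r subrKC.
  by rewrite ger0_norm ?powR_ge0.
Unshelve. all: by end_near. Qed.

(** The support is compact and misses 0, hence stays at a positive distance from 0 and is bounded.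
    Off the support phi vanishes in a neighbourhood, so its derivative vanishes too. *)
Lemma test_function_support (R : realType) (phi : R -> R) : test_function phi ->
  exists a b : R, [/\ 0 < a, a < b &
    forall x : R, x <= a \/ b <= x -> phi x = 0 /\ derive1 phi x = 0].
Proof.
move=> [_ cS S0].
set S := closure _ in cS S0.
have oS : open (~` S) by rewrite openC; exact: closed_closure.
have out x : ~ S x -> phi x = 0 /\ derive1 phi x = 0.
  move=> Sx; have nx : \forall y \near x, phi y = 0.
    have /filterS : nbhs x (~` S) by apply: open_nbhs_nbhs; split.
    by apply=> y Sy; apply/eqP/negPn/negP => y0; apply/Sy/subset_closure.
  split; first exact: nbhs_singleton nx.
  rewrite derive1E (@near_eq_derive _ _ _ _ (cst 0)) ?derive_cst//.
have : nbhs (0 : R) (~` S).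
  by apply: open_nbhs_nbhs; split => // /S0 /=; rewrite in_itv/= ltxx.
move=> /nbhs_ballP[e /= e0 eS].
have [M [_ MS]] := compact_bounded cS.
have eM : M < `|M| + e + 1 by have := ler_norm M; lra.
exists (e / 2), (`|M| + e + 1); split; first by rewrite divr_gt0.
  by have := normr_ge0 M; lra.
move=> x xe; apply: out => Sx; have := S0 _ Sx; rewrite /= in_itv/= andbT => x0.
case: xe => xe.
  apply: (eS x) => //; rewrite /ball/= sub0r normrN gtr0_norm//; lra.
have h : M < `|M| + e / 2 by have := ler_norm M; lra.
by have := MS _ h x Sx; rewrite /= (gtr0_norm x0); lra.
Qed.

Lemma integral_supported (R : realType) (f : R -> R) (a b : R) : 0 < a ->
  (forall x, 0 < x -> x < a \/ b < x -> f x = 0) ->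
  (\int[lebesgue_measure]_(x in `]0%R, +oo[) (f x)%:E =
   \int[lebesgue_measure]_(x in `[a, b]) (f x)%:E)%E.
Proof.
move=> a0 f0; rewrite integral_mkcond [RHS]integral_mkcond.
apply: eq_integral => x _; rewrite !patchE !mem_setE !in_itv/= andbT.
have [x0|x0] := ltP 0 x; last by rewrite (@leNgt _ _ a) (le_lt_trans x0 a0).
have [ax|xa] := leP a x; last by rewrite f0//; left.
by have [xb|bx] := leP x b; last by rewrite f0//; right.
Qed.

Lemma within_itv_continuous (R : realType) (f : R -> R) (a b : R) : 0 < a ->
  (forall x, 0 < x -> {for x, continuous f}) -> {within `[a, b], continuous f}.
Proof.
move=> a0 cf; apply: continuous_in_subspaceT => x; rewrite inE/= in_itv/=.
by move=> /andP[ax _]; apply: cf; apply: lt_le_trans ax.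
Qed.

Lemma is_derive_weighted (R : realType) (p g c : R) (phi : R -> R) (x dphi : R) :
  1 < p -> 0 < x -> is_derive x 1 phi dphi ->
  is_derive x 1 (fun x => c * (`|phi x| `^ p * x `^ g))
    (c * (dnorm_powR p (phi x) * dphi * x `^ g + `|phi x| `^ p * (g * x `^ (g - 1)))).
Proof.
move=> p1 x0 dphix.
have d1 := @is_derive1_comp _ _ _ x _ _ (is_derive_norm_powR (phi x) p1) dphix.
have d2 := is_deriveM d1 (is_derive1_powR g x0).
apply: (is_derive_eq (is_deriveZ c d2)).
by rewrite /GRing.scale/= ; ring.
Qed.

(** With y = phi(x) and dy = phi'(x), the second summand is the derivative of -sg(g) B^(p-1) |phi|^p
    x^g. Its part without dy equals -p B^p times the potential term, because sg(g) g = p B; its part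
    with dy is at most the cross term of [hardy_young]. *)
Lemma continuous_hardy_pointwise (R : realType) (alpha p g B x y dy : R) :
  1 < p -> 0 < x -> g = alpha - p + 1 -> B = `|g / p| ->
  B `^ p * (`|y| `^ p * x `^ (alpha - p)) +
  - (Num.sg g * B `^ (p - 1)) *
      (dnorm_powR p y * dy * x `^ g + `|y| `^ p * (g * x `^ (g - 1))) <=
  `|dy| `^ p * x `^ alpha.
Proof.
move=> p1 x0 gE BE.
have p0 : 0 < p by apply: lt_trans p1.
have pE : p != 0 by rewrite gt_eqF.
have B0 : 0 <= B by rewrite BE.
have h := hardy_young alpha p1 B0 x0 (normr_ge0 dy) (normr_ge0 y).
rewrite -gE in h.
have -> : x `^ (g - 1) = x `^ (alpha - p) by congr (_ `^ _); rewrite gE; ring.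
have gB : Num.sg g * g = p * B.
  by rewrite -normrEsg BE normf_div (gtr0_norm p0) mulrCA divff// mulr1.
have hd : - (Num.sg g * B `^ (p - 1)) * (dnorm_powR p y * dy * x `^ g) <=
    B `^ (p - 1) * (p * `|y| `^ (p - 1) * `|dy| * x `^ g).
  have := dnorm_powR_norm y p1; move: (dnorm_powR p y) => D DE.
  apply: le_trans (ler_norm _) _; rewrite !normrM normrN normrM normr_sg DE.
  rewrite !(ger0_norm (powR_ge0 _ _)).
  by rewrite -mulrA ler_piMl ?mulr_ge0 ?powR_ge0 ?(ltW p0)//; case: (g != 0).
have e : - (Num.sg g * B `^ (p - 1)) * (`|y| `^ p * (g * x `^ (alpha - p))) =
   - p * (B `^ p * (`|y| `^ p * x `^ (alpha - p))).
  rewrite -(mulr_powRB1 B0 p0).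
  transitivity (- (Num.sg g * g) * (B `^ (p - 1) * (`|y| `^ p * x `^ (alpha - p)))); first by ring.
  by rewrite gB; ring.
rewrite mulrDr e.
move: h hd; move: (B `^ p * _) (`|y| `^ (p - 1)) (x `^ g) (B `^ _) => X Y Z W.
by clear; lra.
Qed.

Lemma continuous_hardy_Adisc (R : realType) (p alpha : R) : 1 < p ->
  continuous_hardy alpha p (`|(alpha - p + 1) / p| `^ p).
Proof.
move=> p1 phi tphi; have p0 : 0 < p by apply: lt_trans p1.
have [a [b [a0 ab supp]]] := test_function_support tphi.
have [dphi _ _] := tphi.
have supp' (x : R) : x < a \/ b < x -> phi x = 0 /\ derive1 phi x = 0.
  by move=> h; apply: supp; case: h => /ltW; [left|right].
rewrite (@integral_supported _ _ a b)//; last first.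
  by move=> x _ /supp'[-> _]; rewrite normr0 powR0 ?mul0r ?gt_eqF.
rewrite [leRHS](@integral_supported _ _ a b)//; last first.
  by move=> x _ /supp'[_ ->]; rewrite normr0 powR0 ?mul0r ?gt_eqF.
set g := alpha - p + 1; set B : R := `|g / p|.
pose c := - (Num.sg g * B `^ (p - 1)).
have d0 (x : R) : is_derive x 1 phi (derive1 phi x).
  by split; [exact: (dphi 0%N)|rewrite derive1E].
have c0 (x : R) : {for x, continuous phi} by exact: is_derive_continuous (d0 x).
have c1 (x : R) : {for x, continuous (derive1 phi)}.
  by apply/differentiable_continuous/derivable1_diffP; exact: (dphi 1%N).
have cP (r x : R) : 0 < x -> {for x, continuous (fun x : R => x `^ r)}.
  by move=> x0; exact: is_derive_continuous (is_derive1_powR r x0).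
have cN (x : R) (f : R -> R) : {for x, continuous f} -> {for x, continuous (fun x : R => `|f x| `^ p)}.
  move=> cf; have := @continuous_comp R R R f (fun t => `|t| `^ p) x cf.
  by apply; apply: continuous_norm_powR.
have cd (x : R) : {for x, continuous (fun x : R => dnorm_powR p (phi x))}.
  have := @continuous_comp R R R phi (dnorm_powR p) x (c0 x).
  by apply; apply: continuous_dnorm_powR.
pose h (x : R) : R := c * (dnorm_powR p (phi x) * derive1 phi x * x `^ g +
   `|phi x| `^ p * (g * x `^ (g - 1))).
pose H (x : R) : R := c * (`|phi x| `^ p * x `^ g).
have dH (x : R) : 0 < x -> is_derive x 1 H (h x).
  by move=> x0; exact: is_derive_weighted.
have cf : {within `[a, b], continuous (fun x : R => `|derive1 phi x| `^ p * x `^ alpha)}.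
  by apply: within_itv_continuous => // x x0; apply: cvgM; [exact: cN|exact: cP].
have cg : {within `[a, b], continuous (fun x : R => B `^ p * (`|phi x| `^ p * x `^ (alpha - p)))}.
  apply: within_itv_continuous => // x x0; apply: cvgMl_tmp.
  by apply: cvgM; [exact: cN|exact: cP].
have ch : {within `[a, b], continuous h}.
  apply: within_itv_continuous => // x x0; apply: cvgMl_tmp; apply: cvgD.
    by apply: cvgM; [apply: cvgM; [exact: cd|exact: c1]|exact: cP].
  by apply: cvgM; [exact: cN|apply: cvgMl_tmp; exact: cP].
have int (f : R -> R) : {within `[a, b], continuous f} ->
    lebesgue_measure.-integrable `[a, b] (EFin \o f).
  by apply: continuous_compact_integrable; exact: segment_compact.
have cH (x : R) : 0 < x -> {for x, continuous H} by move=> /dH; exact: is_derive_continuous.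
(* [h] is the derivative of [H], and [H] vanishes at a and b together with phi, so adding [h] to the
   integrand on the left changes nothing. *)
have Hh : (\int[lebesgue_measure]_(x in `[a, b]) (h x)%:E = 0)%E.
  rewrite (@continuous_FTC2 _ h H)//.
  - rewrite /H; have [-> _] := supp b (or_intror (lexx _)).
    have [-> _] := supp a (or_introl (lexx _)).
    by rewrite normr0 powR0 ?gt_eqF// !mul0r mulr0 -EFinB subrr.
  - split.
    + by move=> x; rewrite in_itv/= => /andP[ax _]; have [] := dH x (lt_trans a0 ax).
    + by apply: cvg_at_right_filter; exact: cH.
    + by apply: cvg_at_left_filter; apply: cH; exact: lt_trans ab.
  - move=> x; rewrite in_itv/= => /andP[ax _]; rewrite derive1E.
    by have [_ ->] := dH x (lt_trans a0 ax).
have cg0 : {within `[a, b], continuous (fun x : R => `|phi x| `^ p * x `^ (alpha - p))}.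
  by apply: within_itv_continuous => // x x0; apply: cvgM; [exact: cN|exact: cP].
rewrite -integralZl//; last exact: (int _ cg0).
rewrite -[leLHS]adde0 -Hh -integralD//=; [|exact: (int _ cg)|exact: (int _ ch)].
apply: le_integral => //=; first exact: (integrableD _ (int _ cg) (int _ ch)).
  exact: (int _ cf).
move=> x; rewrite inE/= in_itv/= => /andP[ax _].
rewrite -EFinM -EFinD lee_fin.
by apply: continuous_hardy_pointwise => //; apply: lt_le_trans ax.
Qed.

(** * Test functions at logarithmic scale *)

(** The powers of 1/t are carried along so that the family generated by exp(-1/t), the case m = 0,
    is closed under differentiation. *)
Definition flat_exp (R : realType) (m : nat) (t : R) : R :=
  if 0 < t then t^-1 ^+ m * expR (- t^-1) else 0.

Lemma flat_exp_le0 (R : realType) m (t : R) : t <= 0 -> flat_exp m t = 0.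
Proof. by rewrite /flat_exp ltNge => ->. Qed.

Lemma flat_exp_ge0 (R : realType) m (t : R) : 0 <= flat_exp m t.
Proof.
rewrite /flat_exp; case: ifPn => // t0.
by rewrite mulr_ge0 ?exprn_ge0 ?expR_ge0// invr_ge0 ltW.
Qed.

(** This is y^m / m! <= exp y at y = 1/t. *)
Lemma flat_exp_le (R : realType) m (t : R) : flat_exp m t <= m`!%:R.
Proof.
rewrite /flat_exp; case: ifPn => // t0.
rewrite expRN ler_pdivrMr ?expR_gt0//.
have V0 : 0 <= t^-1 by rewrite invr_ge0 ltW.
case: m => [|m].
  by rewrite expr0 fact0 mul1r; apply: le_trans (expR_ge1Dx _); rewrite lerDl.
have := expR_ge1Dxn m V0.
have f0 : 0 < m.+1`!%:R :> R by rewrite ltr0n fact_gt0.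
rewrite -(ler_pM2l f0) mulrDr mulrCA divff ?gt_eqF// !mulr1; lra.
Qed.

Lemma flat_expSS (R : realType) m (t : R) : flat_exp m t = t ^+ 2 * flat_exp m.+2 t.
Proof.
rewrite /flat_exp; case: ifPn => t0; last by rewrite mulr0.
by rewrite !exprS; field; rewrite gt_eqF.
Qed.

Lemma is_derive_flat_exp (R : realType) m (t : R) :
  is_derive t 1 (flat_exp m) (flat_exp m.+2 t - m%:R * flat_exp m.+1 t).
Proof.
have [t0|t0|->] := ltgtP t 0.
- apply: (@near_eq_is_derive _ _ _ (cst 0)).
    by near=> s; rewrite flat_exp_le0//; apply/ltW; near: s; exact: lt_nbhsl.
  by rewrite !flat_exp_le0 ?(ltW t0)// mulr0 subrr; exact: is_derive_cst.
- apply: (@near_eq_is_derive _ _ _ ((fun s : R => s^-1) ^+ m * (expR \o (fun s : R => - s^-1)))).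
    by near=> s; rewrite /flat_exp ifT ?fctE ?exprfctE//; near: s; exact: lt_nbhsr.
  have tn0 : t != 0 by rewrite gt_eqF.
  have dV : is_derive t 1 (fun s : R => s^-1) (- t ^- 2).
    apply: (is_derive_eq (@is_deriveV R id t 1 1 tn0 (is_derive_id _ _))).
    by rewrite /GRing.scale/= mulr1.
  have dm := is_deriveX m dV.
  have de := @is_derive1_comp _ expR (fun s : R => - s^-1) t _ _
     (is_derive_expR _) (is_deriveN dV).
  apply: (is_derive_eq (is_deriveM dm de)).
  rewrite /flat_exp t0 /GRing.scale/= exprfctE.
  by case: m {dm} => [|m] /=; rewrite !exprS ?expr0; field.
- rewrite !flat_exp_le0// mulr0 subrr.
  (* At 0 the function is O(h^2): pulling out h^2 leaves [flat_exp m.+2], which is bounded by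
     (m+2)!. *)
  apply: (@is_derive_flat _ _ _ m.+2`!%:R 1) => // h.
  rewrite addr0 (flat_exp_le0 m (lexx 0)) subr0 ger0_norm ?flat_exp_ge0//.
  rewrite (_ : 1 + 1 = 2%:R)// powR_mulrn// -normrX ger0_norm ?sqr_ge0//.
  by rewrite flat_expSS mulrC ler_wpM2r ?sqr_ge0// flat_exp_le.
Unshelve. all: by end_near. Qed.

(* Since [ln] is 0 on nonpositive reals, this vanishes for [x <= 1], so the
   value of [x `^ s] there is irrelevant. *)
Definition log_bump (R : realType) (L s : R) (m n : nat) (x : R) : R :=
  x `^ s * flat_exp m (ln x / L) * flat_exp n (1 - ln x / L).

Lemma log_bump_lt1 (R : realType) (L s : R) m n (x : R) : 0 < L -> x <= 1 ->
  log_bump L s m n x = 0.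
Proof.
move=> L0 x1; rewrite /log_bump [flat_exp m _]flat_exp_le0 ?mulr0 ?mul0r//.
by rewrite mulr_le0_ge0 ?invr_ge0 ?(ltW L0)// ln_le0.
Qed.

(** The factor 1/x from differentiating ln x is absorbed into the exponent s - 1, so that only
    functions of the same family occur. *)
Definition log_bump_deriv (R : realType) (L s : R) (m n : nat) (x : R) : R :=
  s * log_bump L (s - 1) m n x +
  (L^-1 * log_bump L (s - 1) m.+2 n x +
  (- (L^-1 * m%:R) * log_bump L (s - 1) m.+1 n x +
  (- L^-1 * log_bump L (s - 1) m n.+2 x +
  L^-1 * n%:R * log_bump L (s - 1) m n.+1 x))).

Lemma is_derive_log_bump (R : realType) (L s : R) m n (x : R) : 0 < L ->
  is_derive x 1 (log_bump L s m n) (log_bump_deriv L s m n x).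
Proof.
move=> L0; have [x1|x1] := ltP x 1.
  rewrite /log_bump_deriv !log_bump_lt1 ?(ltW x1)// !mulr0 !addr0.
  apply: (@near_eq_is_derive _ _ _ (cst 0)).
    by near=> y; rewrite log_bump_lt1//; apply: ltW; near: y; exact: lt_nbhsl.
have x0 : 0 < x by apply: lt_le_trans x1.
have dl : is_derive x 1 (fun y : R => ln y / L) (x^-1 / L).
  apply: (is_derive_eq (is_deriveM (is_derive1_ln x0) (is_derive_cst (L^-1) x 1))).
  by rewrite /GRing.scale/= mulr0 add0r mulrC.
have dl1 : is_derive x 1 (fun y : R => 1 - ln y / L) (- (x^-1 / L)).
  apply: (is_derive_eq (is_deriveB (is_derive_cst (1 : R) x 1) dl)).
  by rewrite sub0r.
have d1 := @is_derive1_comp _ (flat_exp m) _ x _ _ (is_derive_flat_exp m _) dl.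
have d2 := @is_derive1_comp _ (flat_exp n) _ x _ _ (is_derive_flat_exp n _) dl1.
apply: (is_derive_eq (is_deriveM (is_deriveM (is_derive1_powR s x0) d1) d2)).
rewrite /log_bump_deriv /log_bump /GRing.scale !fctE/=.
have -> : x `^ s = x * x `^ (s - 1).
  by rewrite -{2}(powRr1 (ltW x0)) -gt0_powRD// addrC subrK.
by field; rewrite !gt_eqF.
Unshelve. all: by end_near. Qed.

(* Smoothness of [log_bump] follows because this span is stable under
   differentiation. *)
Inductive log_bump_span (R : realType) (L : R) : (R -> R) -> Prop :=
| LogBumpTerm c s m n : log_bump_span L (fun x => c * log_bump L s m n x)
| LogBumpAdd f g : log_bump_span L f -> log_bump_span L g ->
    log_bump_span L (fun x => f x + g x).

Lemma log_bump_span_derive (R : realType) (L : R) (f : R -> R) : 0 < L ->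
  log_bump_span L f ->
  exists2 df, log_bump_span L df & forall x : R, is_derive x 1 f (df x).
Proof.
move=> L0; elim=> [c s m n|{}f g _ [df sf fdf] _ [dg sg gdg]]; last first.
  exists (fun x => df x + dg x); first exact: LogBumpAdd.
  by move=> x; exact: is_deriveD.
exists (fun x => c * s * log_bump L (s - 1) m n x +
  (c * L^-1 * log_bump L (s - 1) m.+2 n x +
  (c * - (L^-1 * m%:R) * log_bump L (s - 1) m.+1 n x +
  (c * - L^-1 * log_bump L (s - 1) m n.+2 x +
  c * (L^-1 * n%:R) * log_bump L (s - 1) m n.+1 x)))).
  by do 4?apply: LogBumpAdd; exact: LogBumpTerm.
move=> x; apply: (is_derive_eq (is_deriveZ c (is_derive_log_bump s m n x L0))).
rewrite /log_bump_deriv /GRing.scale/=; ring.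
Qed.

Lemma derivable_log_bump (R : realType) (L s : R) k m n (x : R) : 0 < L ->
  derivable (derive1n k (log_bump L s m n)) x 1.
Proof.
move=> L0.
suff H f : log_bump_span L f -> log_bump_span L (derive1n k f).
  have /H : log_bump_span L (fun y => 1 * log_bump L s m n y) by exact: LogBumpTerm.
  rewrite (_ : (fun y => 1 * _) = log_bump L s m n); last first.
    by apply: funext => y; rewrite mul1r.
  by move=> /(log_bump_span_derive L0)[df _ /(_ x)[]].
elim: k f => [//|k IH] f /IH.
rewrite /derive1n iterS => /(log_bump_span_derive L0)[df sdf dfE].
rewrite (_ : derive1 _ = df)//; apply: funext => y; rewrite derive1E.
by have [] := dfE y.
Qed.

Lemma log_bump_out (R : realType) (L s : R) m n (x : R) : 0 < L ->
  x <= 1 \/ expR L <= x -> log_bump L s m n x = 0.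
Proof.
move=> L0 [x1|Lx]; first exact: log_bump_lt1.
have x0 : 0 < x by apply: lt_le_trans Lx; exact: expR_gt0.
rewrite /log_bump [flat_exp n _]flat_exp_le0 ?mulr0// subr_le0 ler_pdivlMr// mul1r.
by rewrite -ler_expR lnK.
Qed.

Lemma test_function_log_bump (R : realType) (L s : R) : 0 < L ->
  test_function (log_bump L s 0 0).
Proof.
move=> L0; pose S := closure [set x | log_bump L s 0 0 x != 0].
have SI : S `<=` `[1, expR L].
  have -> : `[1, expR L]%classic = closure `[1, expR L]%classic :> set R.
    by apply/closure_id; exact: interval_closed.
  apply: closureS => x /= nz; rewrite in_itv/=.
  have [x1|x1] := leP x 1; first by rewrite log_bump_lt1 ?eqxx in nz.
  have [xL|Lx] := leP x (expR L); first by rewrite (ltW x1).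
  by move: nz; rewrite (log_bump_out _ _ _ L0 (or_intror (ltW Lx))) eqxx.
split.
- by move=> k x; exact: derivable_log_bump.
- apply: (subclosed_compact _ (@segment_compact R 1 (expR L))) => //.
  exact: closed_closure.
- move=> x /SI /=; rewrite !in_itv/= andbT => /andP[x1 _].
  exact: lt_le_trans x1.
Qed.

(** * Size estimates for the logarithmic test functions *)

(** The bump eta: exp(-1/t - 1/(1-t)) on (0, 1), and 0 elsewhere. *)
Definition profile (R : realType) (t : R) : R := flat_exp 0 t * flat_exp 0 (1 - t).

Definition dprofile (R : realType) (t : R) : R :=
  flat_exp 2 t * flat_exp 0 (1 - t) - flat_exp 0 t * flat_exp 2 (1 - t).

Lemma profile_ge0 (R : realType) (t : R) : 0 <= profile t.
Proof. by rewrite mulr_ge0 ?flat_exp_ge0. Qed.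

Lemma profile_le1 (R : realType) (t : R) : profile t <= 1.
Proof. by rewrite mulr_ile1 ?flat_exp_ge0//; exact: (flat_exp_le 0). Qed.

(** Each of the two factors is at least exp(-3) on the middle third. This bounds the potential terms
    from below in both sharpness proofs. *)
Lemma profile_ge (R : realType) (t : R) : 1 / 3 <= t -> t <= 2 / 3 ->
  expR (- 6) <= profile t.
Proof.
move=> t1 t2.
have H (s : R) : 1 / 3 <= s -> expR (- 3) <= flat_exp 0 s.
  move=> s3; have s0 : 0 < s by lra.
  rewrite /flat_exp s0 mul1r ler_expR lerN2 -[leRHS]invrK lef_pV2 ?posrE ?invr_gt0//.
  by rewrite div1r in s3.
have -> : - 6 = - 3 + - 3 :> R by ring.
by rewrite expRD ler_pM ?expR_ge0 ?H//; lra.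
Qed.

Lemma is_derive_profile (R : realType) (t : R) : is_derive t 1 (@profile R) (dprofile t).
Proof.
have d1 : is_derive t 1 (fun y : R => 1 - y) (- 1).
  apply: (is_derive_eq (is_deriveB (is_derive_cst (1 : R) t 1) (is_derive_id t 1))).
  by rewrite sub0r.
have d2 := @is_derive1_comp _ (flat_exp 0) _ t _ _ (is_derive_flat_exp 0 _) d1.
apply: (is_derive_eq (is_deriveM (is_derive_flat_exp 0 t) d2)).
rewrite /dprofile /GRing.scale/=; ring.
Qed.

Lemma dprofile_le (R : realType) (t : R) : `|dprofile t| <= 2.
Proof.
have H (s r : R) : 0 <= flat_exp 2 s * flat_exp 0 r <= 2.
  rewrite mulr_ge0 ?flat_exp_ge0//=.
  have -> : 2 = 2 * 1 :> R by rewrite mulr1.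
  by rewrite ler_pM ?flat_exp_ge0//; [exact: (flat_exp_le 2)|exact: (flat_exp_le 0)].
have /andP[a0 a2] := H t (1 - t); have /andP[b0 b2] := H (1 - t) t.
rewrite ler_norml /dprofile (mulrC (flat_exp 0 t)); apply/andP; split; lra.
Qed.

(** The exponent s = -(alpha - p + 1) / p is the one with s p + alpha - p = -1, which leaves the
    scale-invariant density 1/x. *)
Lemma log_bump_weight (R : realType) (alpha p L x : R) : 1 < p -> 0 < x ->
  `|log_bump L (- ((alpha - p + 1) / p)) 0 0 x| `^ p * x `^ (alpha - p) =
  x^-1 * profile (ln x / L) `^ p.
Proof.
move=> p1 x0; have pE : p != 0 by rewrite gt_eqF// (lt_trans _ p1).
rewrite /log_bump -mulrA -/(profile _) normrM.
rewrite (ger0_norm (powR_ge0 _ _)) (ger0_norm (profile_ge0 _)).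
rewrite powRM ?powR_ge0 ?profile_ge0// -powRrM mulrAC -gt0_powRD//.
rewrite (_ : _ + (alpha - p) = -1) ?powR_inv1 ?(ltW x0)//; by field.
Qed.

(** Here phi' = x^(s-1) (s eta + eta'/L), and the bracket is at most B eta + 2/L in absolute value.
    The tangent inequality for t^p separates (B eta)^p from an error of order 1/L. *)
Lemma log_bump_gradient_le (R : realType) (alpha p B L x : R) :
  1 < p -> 1 <= L -> 0 < x -> B = `|(alpha - p + 1) / p| ->
  `|log_bump_deriv L (- ((alpha - p + 1) / p)) 0 0 x| `^ p * x `^ alpha <=
  x^-1 * (B `^ p * profile (ln x / L) `^ p + 2 * p * (B + 2) `^ (p - 1) / L).
Proof.
move=> p1 L1 x0 BE; have pE : p != 0 by rewrite gt_eqF// (lt_trans _ p1).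
have p0 : 0 < p by apply: lt_trans p1.
have L0 : 0 < L by apply: lt_le_trans L1.
set s := - _; set t := ln x / L.
have -> : log_bump_deriv L s 0 0 x = x `^ (s - 1) * (s * profile t + dprofile t / L).
  by rewrite /log_bump_deriv /log_bump -/t /profile /dprofile; field; rewrite gt_eqF.
rewrite normrM (ger0_norm (powR_ge0 _ _)) powRM ?powR_ge0// -powRrM mulrAC -gt0_powRD//.
rewrite (_ : _ + alpha = -1) ?powR_inv1 ?(ltW x0)//; last by rewrite /s; field.
rewrite ler_wpM2l ?invr_ge0 ?(ltW x0)//.
have B0 : 0 <= B by rewrite BE.
have P0 := profile_ge0 t; have P1 := profile_le1 t.
have BP0 : 0 <= B * profile t by rewrite mulr_ge0.
have L2 : 0 <= 2 / L by rewrite divr_ge0// ltW.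
have L2' : 2 / L <= 2 by rewrite ler_pdivrMr// ler_peMr.
have h1 : `|s * profile t + dprofile t / L| <= B * profile t + 2 / L.
  apply: (le_trans (ler_normD _ _)).
  have sB : `|s| = B by rewrite BE /s normrN.
  rewrite (normrM s) (normrM (dprofile t)) sB (ger0_norm P0) lerD2l.
  have Li : 0 <= L^-1 by rewrite invr_ge0 ltW.
  by rewrite (ger0_norm Li) ler_wpM2r ?dprofile_le.
apply: (@le_trans _ _ ((B * profile t + 2 / L) `^ p)).
  by rewrite ge0_ler_powR ?nnegrE ?normr_ge0 ?(ltW p0)// addr_ge0.
have := powR_tangent p1 BP0 (addr_ge0 BP0 L2).
rewrite powRM// lerBlDl => /le_trans; apply.
rewrite lerD2l (_ : _ + 2 / L - _ = 2 / L); last by ring.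
have -> : 2 * p * (B + 2) `^ (p - 1) / L = p * ((B + 2) `^ (p - 1) * (2 / L)).
  by field; rewrite gt_eqF.
rewrite ler_pM2l// ler_wpM2r// ge0_ler_powR ?nnegrE ?subr_ge0 ?(ltW p1) ?addr_ge0//.
by rewrite lerD// ler_piMr.
Qed.

Lemma integral_inv (R : realType) (a b : R) : 0 < a -> a < b ->
  (\int[lebesgue_measure]_(x in `[a, b]) (x^-1)%:E = (ln b - ln a)%:E)%E.
Proof.
move=> a0 ab; have b0 := lt_trans a0 ab.
rewrite (@continuous_FTC2 _ (fun x : R => x^-1) (@ln R))//.
- by apply: within_itv_continuous => // x x0; apply: inv_continuous; rewrite gt_eqF.
- split.
  + by move=> x; rewrite in_itv/= => /andP[ax _]; have [] := is_derive1_ln (lt_trans a0 ax).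
  + by apply: cvg_at_right_filter; exact: continuous_ln.
  + by apply: cvg_at_left_filter; exact: continuous_ln.
- move=> x; rewrite in_itv/= => /andP[ax _]; rewrite derive1E.
  by have [_ ->] := is_derive1_ln (lt_trans a0 ax).
Qed.

(** * Sharpness of the continuous constant *)

Lemma continuous_hardy_sharp (R : realType) (p alpha C : R) : 1 < p ->
  continuous_hardy alpha p C -> C <= `|(alpha - p + 1) / p| `^ p.
Proof.
move=> p1 hC; rewrite leNgt; apply/negP; set B : R := `|_|; set A := B `^ p => AC.
have p0 : 0 < p by apply: lt_trans p1.
have pE : p != 0 by rewrite gt_eqF.
(* The error constant of [log_bump_gradient_le]: K / (L x) integrates to exactly K over
   [1, exp L]. *)
pose K := 2 * p * (B + 2) `^ (p - 1).
have K0 : 0 <= K by apply: mulr_ge0; [apply: mulr_ge0; [|exact: ltW]|exact: powR_ge0].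
pose c0 : R := expR (- 6) `^ p.
have c00 : 0 < c0 by rewrite powR_gt0 ?expR_gt0.
have CA : 0 < C - A by rewrite subr_gt0.
have CAc : 0 < (C - A) * c0 by rewrite mulr_gt0.
(* The test function will give (C - A) J <= K for the potential integral J, whereas J >= c0 L / 3; L
   is taken so large that these conflict. *)
have [L L1 KL] : exists2 L : R, 1 <= L & K < (C - A) * (c0 * (L / 3)).
  exists (1 + 3 * K / ((C - A) * c0)).
    by rewrite lerDl; apply: divr_ge0; [apply: mulr_ge0|exact: ltW].
  have -> : (C - A) * (c0 * ((1 + 3 * K / ((C - A) * c0)) / 3)) = (C - A) * c0 / 3 + K.
    by field; rewrite !gt_eqF.
  by rewrite ltrDr divr_gt0.
have L0 : 0 < L by apply: lt_le_trans L1.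
pose s := - ((alpha - p + 1) / p).
have := hC _ (test_function_log_bump s L0).
have d (x : R) : is_derive x 1 (log_bump L s 0 0) (log_bump_deriv L s 0 0 x) :=
  is_derive_log_bump s 0 0 x L0.
have out (x : R) : 0 < x -> x < 1 \/ expR L < x -> log_bump L s 0 0 x = 0.
  by move=> _ [/ltW|/ltW] h; apply: log_bump_out => //; [left|right].
have out' (x : R) : 0 < x -> x < 1 \/ expR L < x -> derive1 (log_bump L s 0 0) x = 0.
  move=> _ h; rewrite derive1E; have [_ ->] := d x.
  rewrite /log_bump_deriv !log_bump_out ?mulr0 ?addr0//;
  by case: h => /ltW; [left|right].
rewrite (@integral_supported _ _ 1 (expR L))//; last first.
  by move=> x x0 h; rewrite out// normr0 powR0 ?mul0r.
rewrite [leRHS](@integral_supported _ _ 1 (expR L))//; last first.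
  by move=> x x0 h; rewrite out'// normr0 powR0 ?mul0r.
have e1 : 1 < expR L by rewrite -[ltLHS]expR0 ltr_expR.
have cln (x : R) : 0 < x -> {for x, continuous (fun x : R => profile (ln x / L) `^ p)}.
  move=> x0.
  have -> : (fun x : R => profile (ln x / L) `^ p) = (fun x : R => `|profile (ln x / L)| `^ p).
    by apply: funext => y; rewrite ger0_norm ?profile_ge0.
  have := @continuous_comp R R R (fun x : R => profile (ln x / L)) (fun t => `|t| `^ p) x.
  apply; last exact: continuous_norm_powR.
  have := @continuous_comp R R R (fun x : R => ln x / L) (@profile R) x.
  apply; last exact: is_derive_continuous (is_derive_profile _).
  by apply: cvgMr_tmp; exact: continuous_ln.
have cV (x : R) : 0 < x -> {for x, continuous (fun x : R => x^-1)}.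
  by move=> x0; apply: inv_continuous; rewrite gt_eqF.
have int (f : R -> R) (a b : R) : 0 < a -> (forall x : R, 0 < x -> {for x, continuous f}) ->
    lebesgue_measure.-integrable `[a, b] (EFin \o f).
  move=> a0 cf; apply: continuous_compact_integrable; first exact: segment_compact.
  exact: within_itv_continuous.
pose w (x : R) : R := x^-1 * profile (ln x / L) `^ p.
have cw (x : R) : 0 < x -> {for x, continuous w}.
  by move=> x0; apply: cvgM; [exact: cV|exact: cln].
have w0 (x : R) : 0 < x -> 0 <= w x by move=> x0; rewrite mulr_ge0 ?powR_ge0 ?invr_ge0 ?ltW.
have ie (x : R) : x \in (`[1, expR L]%classic : set R) -> 0 < x.
  by rewrite inE/= in_itv/= => /andP[x1 _]; exact: lt_le_trans x1.
pose J := (\int[lebesgue_measure]_(x in `[1%R, expR L]) (w x)%:E)%E.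
have -> : (\int[lebesgue_measure]_(x in `[1%R, expR L])
    (`|log_bump L s 0 0 x| `^ p * x `^ (alpha - p))%:E = J)%E.
  by apply: eq_integral => x /ie x0; rewrite log_bump_weight.
have Jfin : J \is a fin_num by apply: integrable_fin_num => //; exact: int.
have JE : (\int[lebesgue_measure]_(x in `[1%R, expR L]) (A * w x)%:E = (A * fine J)%:E)%E.
  under eq_integral do rewrite EFinM.
  by rewrite integralZl//; [rewrite EFinM fineK|exact: (int w)].
have KE : (\int[lebesgue_measure]_(x in `[1%R, expR L]) (K / L * x^-1)%:E = K%:E)%E.
  under eq_integral do rewrite EFinM.
  rewrite integralZl//; last exact: (int (fun x : R => x^-1)).
  by rewrite integral_inv// expRK ln1 subr0 -EFinM divfK ?gt_eqF.
rewrite -(fineK Jfin) -EFinM => h.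
have : ((C * fine J)%:E <= (A * fine J + K)%:E)%E.
  apply: (le_trans h); rewrite EFinD -JE -KE -integralD//=; last 2 first.
  - by apply: (int (fun x : R => A * w x)) => // x x0; apply: cvgMl_tmp; exact: cw.
  - by apply: (int (fun x : R => K / L * x^-1)) => // x x0; apply: cvgMl_tmp; exact: cV.
  apply: ge0_le_integral => //=.
  - by move=> x _; rewrite lee_fin mulr_ge0 ?powR_ge0.
  - have dn (x : R) : derivable (derive1n 1 (log_bump L s 0 0)) x 1.
      exact: derivable_log_bump.
    have : lebesgue_measure.-integrable `[1, expR L]
       (EFin \o (fun x : R => `|derive1 (log_bump L s 0 0) x| `^ p * x `^ alpha)).
      apply: int => // x x0; apply: cvgM; last first.
        exact: is_derive_continuous (is_derive1_powR _ x0).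
      have := @continuous_comp R R R (derive1 (log_bump L s 0 0)) (fun t => `|t| `^ p) x.
      apply; last exact: continuous_norm_powR.
      by apply/differentiable_continuous/derivable1_diffP; exact: dn.
    by move=> /measurable_int.
  - have : lebesgue_measure.-integrable `[1, expR L]
       (EFin \o (fun x : R => A * w x + K / L * x^-1)).
      by apply: int => // x x0; apply: cvgD; apply: cvgMl_tmp; [exact: cw|exact: cV].
    by move=> /measurable_int.
  - move=> x; rewrite in_itv/= => /andP[x1 _].
    have x0 : 0 < x by apply: lt_le_trans x1.
    rewrite -EFinD lee_fin derive1E; have [_ ->] := d x.
    apply: (le_trans (log_bump_gradient_le p1 L1 x0 erefl)).
    by rewrite -/B -/A -/K /w le_eqVlt; apply/orP; left; apply/eqP; field; rewrite !gt_eqF.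
rewrite lee_fin => CJ.
have e12 : expR (L / 3) < expR (2 * L / 3) by rewrite ltr_expR; lra.
have e13 : 1 <= expR (L / 3) by rewrite -[leLHS]expR0 ler_expR; lra.
have e23 : expR (2 * L / 3) <= expR L by rewrite ler_expR; lra.
(* Only the part where ln x / L lies in [1/3, 2/3] is kept; there eta^p >= c0, and 1/x integrates to
   L / 3. *)
have : ((c0 * (L / 3))%:E <= (fine J)%:E)%E.
  rewrite (fineK Jfin).
  apply: (@le_trans _ _ (\int[lebesgue_measure]_(x in `[expR (L / 3), expR (2 * L / 3)]) (w x)%:E)%E); last first.
    apply: ge0_subset_integral => //=.
    - by have /measurable_int := int w 1 (expR L) ltr01 cw.
    - by move=> x; rewrite in_itv/= => /andP[x1 _]; rewrite lee_fin w0// (lt_le_trans _ x1).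
    - move=> x /=; rewrite !in_itv/= => /andP[h1 h2].
      by rewrite (le_trans e13 h1) (le_trans h2 e23).
  have -> : (c0 * (L / 3))%:E = (\int[lebesgue_measure]_(x in `[expR (L / 3), expR (2 * L / 3)]) (c0 * x^-1)%:E)%E.
    under eq_integral do rewrite EFinM.
    rewrite integralZl//; last by apply: (int (fun x : R => x^-1)) => //; exact: expR_gt0.
    by rewrite integral_inv ?expR_gt0// !expRK -EFinM; congr (_%:E); field.
  apply: ge0_le_integral => //=.
  - move=> x; rewrite in_itv/= => /andP[x1 _].
    by rewrite lee_fin mulr_ge0 ?(ltW c00)// invr_ge0 (le_trans _ x1)// expR_ge0.
  - have : lebesgue_measure.-integrable `[expR (L / 3), expR (2 * L / 3)] (EFin \o (fun x : R => c0 * x^-1)).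
      by apply: int => [|x x0]; [exact: expR_gt0|apply: cvgMl_tmp; exact: cV].
    by move=> /measurable_int.
  - by have /measurable_int := int w (expR (L / 3)) (expR (2 * L / 3)) (expR_gt0 _) cw.
  - move=> x; rewrite in_itv/= => /andP[x1 x2]; rewrite lee_fin /w mulrC.
    have x0 : 0 < x by apply: lt_le_trans x1; exact: expR_gt0.
    rewrite ler_wpM2l ?invr_ge0 ?(ltW x0)// ge0_ler_powR ?nnegrE ?expR_ge0 ?profile_ge0 ?(ltW p0)//.
    by apply: profile_ge; [rewrite ler_pdivlMr|rewrite ler_pdivrMr];
      rewrite // -ler_expR lnK// (le_trans _ x1, le_trans x2)// ler_expR; lra.
rewrite lee_fin => cJ.
have h1 : (C - A) * (c0 * (L / 3)) <= K.
  by apply: (le_trans (ler_wpM2l (ltW CA) cJ)); lra.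
by rewrite ltNge h1 in KL.
Qed.

(** * Sharpness of the discrete constant *)

(** Both bounds are instances of ln(1 + y) <= y, with y = -1/x and y = 1/(x-1). *)
Lemma ln_step (R : realType) (x : R) : 1 < x -> x^-1 <= ln x - ln (x - 1) <= (x - 1)^-1.
Proof.
move=> x1; have x0 : 0 < x by apply: lt_trans x1.
have m0 : 0 < x - 1 by rewrite subr_gt0.
rewrite -ln_div ?posrE//; apply/andP; split.
  rewrite -lerN2 -lnV ?posrE ?divr_gt0// invf_div.
  have -> : (x - 1) / x = 1 + - x^-1 by field; rewrite gt_eqF.
  by apply: le_ln1Dx; rewrite ltrN2 invf_lt1.
have -> : x / (x - 1) = 1 + (x - 1)^-1 by field; rewrite gt_eqF.
by apply: le_ln1Dx; rewrite (lt_trans (ltrN10 R))// invr_gt0.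
Qed.

Lemma profile_powR_lipschitz (R : realType) (p s t : R) : 1 < p -> s <= t ->
  profile s `^ p <= profile t `^ p + 2 * p * (t - s).
Proof.
move=> p1 st; have p0 : 0 < p by apply: lt_trans p1.
have [c _ cE] : exists2 c : R, c \in `[s, t]%R &
    @profile R t - profile s = dprofile c * (t - s).
  apply: MVT_segment => // [x _|]; first exact: is_derive_profile.
  apply: continuous_subspaceT => x; exact: is_derive_continuous (is_derive_profile x).
have ts : 0 <= t - s by rewrite subr_ge0.
have hd : profile s - profile t <= 2 * (t - s).
  rewrite -opprB cE -mulNr ler_wpM2r//.
  by apply: le_trans (dprofile_le c); rewrite -normrN ler_norm.
have := powR_tangent p1 (profile_ge0 t) (profile_ge0 s).
rewrite lerBlDl => /le_trans; apply; rewrite lerD2l (mulrC 2) -mulrA ler_pM2l//.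
apply: (@le_trans _ _ (profile s `^ (p - 1) * (2 * (t - s)))).
  by rewrite ler_wpM2l ?powR_ge0.
have e : 1 `^ (p - 1) = 1 :> R by rewrite powR1.
rewrite ler_piMl ?mulr_ge0// -[leRHS]e.
by rewrite ge0_ler_powR ?nnegrE ?profile_ge0 ?profile_le1 ?subr_ge0 ?(ltW p1).
Qed.

(** The mean value theorem reduces the difference to phi'(xi) with x - 1 < xi < x. Replacing xi by x
    costs O(1/(x L)) in eta and O(1/x^2) in the weight. As Q does not depend on L, the errors summed
    over the support stay bounded while the main term grows with L. *)
Lemma log_bump_step (R : realType) (alpha p : R) : 1 < p -> 0 <= alpha ->
  exists2 Q : R, 0 <= Q & forall (L x : R) (phi : R -> R), 1 <= L -> 2 <= x ->
  phi = log_bump L (- ((alpha - p + 1) / p)) 0 0 ->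
  `|phi x - phi (x - 1)| `^ p * x `^ alpha <=
   `|(alpha - p + 1) / p| `^ p * (`|phi x| `^ p * x `^ (alpha - p)) +
   Q * (x^-1 / L + x ^- 2).
Proof.
move=> p1 a0; have p0 : 0 < p by apply: lt_trans p1.
set B : R := `|_|; set A : R := B `^ p.
have A0 : 0 <= A by exact: powR_ge0.
pose K : R := 2 * p * (B + 2) `^ (p - 1).
have K0 : 0 <= K by apply: mulr_ge0; [apply: mulr_ge0; [|exact: ltW]|exact: powR_ge0].
pose E : R := 2 * (alpha + 2) * 2 `^ (alpha + 1).
have E0 : 0 <= E by rewrite /E; apply: mulr_ge0; [apply: mulr_ge0|exact: powR_ge0]; lra.
(* The first summand pays for moving eta^p from xi to x, the second is the error of the gradient
   bound. *)
pose D : R := 2 * p * A + K.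
have D0 : 0 <= D by apply: addr_ge0 => //; apply: mulr_ge0 => //; apply: mulr_ge0 => //; exact: ltW.
exists (D + E * (A + D)); first by rewrite addr_ge0// mulr_ge0// addr_ge0.
move=> L x phi L1 x2 phiE; have L0 : 0 < L by apply: lt_le_trans L1.
have x1 : 1 < x by apply: lt_le_trans x2; rewrite ltr1n.
have x0 : 0 < x by apply: lt_trans x1.
have m0 : 0 < x - 1 by rewrite subr_gt0.
have dphi (y : R) := is_derive_log_bump (- ((alpha - p + 1) / p)) 0 0 y L0.
have [|y _||xi] := @MVT R phi (log_bump_deriv L (- ((alpha - p + 1) / p)) 0 0) (x - 1) x.
- by rewrite gtrBl.
- by rewrite phiE; exact: dphi.
- by apply: continuous_subspaceT => y; rewrite phiE; exact: is_derive_continuous (dphi y).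
rewrite in_itv/= => /andP[xi1 xi2].
rewrite (_ : x - (x - 1) = 1) ?mulr1; last by ring.
move=> ->; rewrite phiE.
have xi0 : 0 < xi by apply: lt_trans xi1.
rewrite log_bump_weight//.
have hg := log_bump_gradient_le p1 L1 xi0 (erefl B); rewrite -/A -/K in hg.
set d := _ `^ p in hg *.
set t := ln x / L; set r := ln xi / L in hg.
have rt : r <= t by rewrite ler_wpM2r ?invr_ge0 ?(ltW L0)// ler_ln ?posrE// ltW.
have tr : t - r <= L^-1.
  rewrite /t /r -mulrBl ler_piMl ?invr_ge0 ?(ltW L0)//.
  have /andP[_ h] := ln_step x1.
  have : ln (x - 1) <= ln xi by rewrite ler_ln ?posrE// ltW.
  have : (x - 1)^-1 <= 1 by rewrite invf_le1//; lra.
  lra.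
have hp := profile_powR_lipschitz p1 rt.
set P := profile t `^ p in hp *.
have P0 : 0 <= P by exact: powR_ge0.
have P1 : P <= 1.
  have e : 1 `^ p = 1 :> R by rewrite powR1.
  rewrite /P -[leRHS]e.
  by rewrite ge0_ler_powR ?nnegrE ?profile_ge0 ?profile_le1 ?(ltW p0).
have hr : (x / xi) `^ (alpha + 1) <= 1 + E / x.
  have Vx : 0 <= 2 / x by rewrite divr_ge0// ltW.
  have Vx1 : 2 / x <= 1 by rewrite ler_pdivrMr// mul1r.
  apply: (@le_trans _ _ ((1 + 2 / x) `^ (alpha + 1))).
    rewrite ge0_ler_powR ?nnegrE ?divr_ge0 ?addr_ge0 ?(ltW x0) ?(ltW xi0)//.
    rewrite ler_pdivrMr//.
    have h : x * x <= (x + 2) * xi.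
      apply: (@le_trans _ _ ((x + 2) * (x - 1))); first by nra.
      by rewrite ler_pM2l ?addr_gt0// ltW.
    rewrite -(ler_pM2l x0); apply: (le_trans h).
    by rewrite le_eqVlt; apply/orP; left; apply/eqP; field; rewrite gt_eqF.
  (* The exponent is raised by one because the tangent inequality requires an exponent above 1 and
     alpha may be 0. *)
  apply: (@le_trans _ _ ((1 + 2 / x) `^ (alpha + 2))).
    by apply: ler_powR; lra.
  have a2 : 1 < alpha + 2 by lra.
  have := powR_tangent a2 ler01 (addr_ge0 ler01 Vx).
  rewrite powR1 lerBlDl => /le_trans; apply; rewrite lerD2l.
  have -> : alpha + 2 - 1 = alpha + 1 by ring.
  have -> : 1 + 2 / x - 1 = 2 / x by ring.
  have -> : E / x = (alpha + 2) * (2 `^ (alpha + 1) * (2 / x)).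
    by rewrite /E; field; rewrite gt_eqF.
  rewrite ler_wpM2l//; first by lra.
  by rewrite ler_wpM2r// ge0_ler_powR ?nnegrE//; lra.
(* This form isolates d xi^alpha xi, which [hg] controls, and leaves the density 1/x and a ratio
   close to 1. *)
have xE : x `^ alpha = xi `^ alpha * xi * x^-1 * (x / xi) `^ (alpha + 1).
  rewrite powRM ?invr_ge0 ?(ltW x0) ?(ltW xi0)// -(powR_inv1 (ltW xi0)).
  rewrite -powRrM mulN1r powRN !gt0_powRD// !powRr1 ?(ltW x0) ?(ltW xi0)//.
  by field; rewrite !gt_eqF// powR_gt0.
have L1' : L^-1 <= 1 by rewrite invf_le1.
have Li : 0 <= L^-1 by rewrite invr_ge0 ltW.
have hAP : A * profile r `^ p + K / L <= A * P + D / L.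
  have : A * profile r `^ p <= A * (P + 2 * p * (t - r)) by rewrite ler_wpM2l.
  have : A * (2 * p * (t - r)) <= A * (2 * p * L^-1).
    by rewrite ler_wpM2l// ler_wpM2l// mulr_ge0// ltW.
  rewrite /D mulrDr mulrDl; lra.
have hd : d * xi `^ alpha * xi <= A * P + D / L.
  apply: le_trans hAP; rewrite -(@ler_pM2l _ xi^-1) ?invr_gt0//.
  by apply: le_trans hg; rewrite mulrC mulfK ?gt_eqF.
have AD0 : 0 <= A * P + D / L by rewrite addr_ge0// mulr_ge0.
apply: (@le_trans _ _ (x^-1 * ((A * P + D / L) * (1 + E / x)))).
  have -> : d * x `^ alpha = x^-1 * (d * xi `^ alpha * xi * (x / xi) `^ (alpha + 1)).
    by rewrite xE; ring.
  by rewrite ler_wpM2l ?invr_ge0 ?(ltW x0)// ler_pM ?powR_ge0 // !mulr_ge0 ?powR_ge0// ltW.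
have hAD : A * P + D / L <= A + D.
  by apply: lerD; [rewrite ler_piMr|rewrite ler_piMr].
have : x ^- 2 * E * (A * P + D / L) <= x ^- 2 * E * (A + D).
  by rewrite ler_wpM2l// mulr_ge0// invr_ge0 exprn_ge0// ltW.
have : 0 <= E * (A + D) * (x^-1 / L).
  apply: mulr_ge0; first by apply: mulr_ge0 => //; exact: addr_ge0.
  by apply: mulr_ge0 => //; rewrite invr_ge0 ltW.
have : 0 <= D * x ^- 2 by rewrite mulr_ge0// invr_ge0 exprn_ge0// ltW.
have -> : x ^- 2 = x^-1 * x^-1 by rewrite expr2 invfM.
move: (x^-1) (L^-1) => y l; clear; lra.
Qed.

Lemma discrete_hardy_sharp (R : realType) (p alpha C : R) : 1 < p -> 0 <= alpha ->
  discrete_hardy alpha p C -> C <= `|(alpha - p + 1) / p| `^ p.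
Proof.
move=> p1 a0 hC; rewrite leNgt; apply/negP.
have [Q Q0 step] := log_bump_step p1 a0; move: step.
set A : R := _ `^ p; pose s : R := - ((alpha - p + 1) / p); rewrite -/s => step ltAC.
have p0 : 0 < p by apply: lt_trans p1.
have pE : p != 0 by rewrite gt_eqF.
pose c0 : R := expR (- 6) `^ p.
have c00 : 0 < c0 by rewrite powR_gt0 ?expR_gt0.
have CA : 0 < C - A by rewrite subr_gt0.
have CAc : 0 < (C - A) * c0 by rewrite mulr_gt0.
(* The total error will be at most 3 Q and the potential sum at least c0 ln M, so ln M >= X yields a
   contradiction. *)
pose X : R := 1 + 3 * Q / ((C - A) * c0).
have X1 : 1 <= X by rewrite lerDl; apply: divr_ge0; [apply: mulr_ge0|exact: ltW].
have QX : 3 * Q < (C - A) * (c0 * X).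
  have -> : (C - A) * (c0 * X) = (C - A) * c0 + 3 * Q by rewrite /X; field; rewrite !gt_eqF.
  by rewrite ltrDr.
(* With L = 3 ln M, the function eta (ln n / L) is bounded below for n in
   [M, M^2] and vanishes for n >= M^3. *)
pose M := (Num.truncn (expR X)).+1.
have XM : X <= ln (M%:R : R).
  by rewrite -ler_expR lnK ?posrE ?ltr0n//; apply/ltW; exact: truncnS_gt.
have M0 : (0 < M)%N by [].
have M0R : 0 < M%:R :> R by rewrite ltr0n.
pose l : R := ln M%:R; pose L := 3 * l.
have lX : X <= l by [].
have l1 : 1 <= l by apply: le_trans lX.
have L1 : 1 <= L by rewrite /L; lra.
have L0 : 0 < L by apply: lt_le_trans L1.
have LE : expR L = (M ^ 3)%:R by rewrite /L expRM_natl lnK ?posrE// natrX.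
pose u n := log_bump L s 0 0 n%:R.
have u0 n : (M ^ 3 <= n)%N -> u n = 0.
  by move=> Mn; apply: log_bump_out => //; right; rewrite LE ler_nat.
have u1 n : (n <= 1)%N -> u n = 0.
  by move=> n1; apply: log_bump_out => //; left; rewrite lern1.
have Hu : H10 u.
  split; first exact: u1.
  apply: (@sub_finite_set _ _ `I_(M ^ 3)); last exact: finite_II.
  by move=> n /= un; rewrite ltnNge; apply: contra un => /u0 ->.
have := hC u Hu.
rewrite (@eseries_finite_support _ _ (M ^ 3).+2); last first.
  by move=> n Mn; rewrite u0 ?normr0 ?powR0 ?mul0r// (leq_trans _ Mn)// leqW.
rewrite (@eseries_finite_support _ _ (M ^ 3).+2); last first.
  move=> [|n] Mn; first by [].
  have Mn' : (M ^ 3 <= n)%N by exact: ltnW.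
  by rewrite (u0 n.+1 (leqW Mn')) (u0 n Mn') subrr normr0 powR0// mul0r.
rewrite -EFinM lee_fin.
set g := fun n => `|u n| `^ p * n%:R `^ (alpha - p).
set f := fun n => `|u n - u n.-1| `^ p * n%:R `^ alpha.
rewrite -/(g _) => hfg.
have g0 n : 0 <= g n by rewrite mulr_ge0 ?powR_ge0.
(* The gradient term at 1 vanishes since u_0 = u_1 = 0; the remaining indices are at least 2, as
   [step] requires. *)
have fE : \sum_(1 <= n < (M ^ 3).+2) f n = \sum_(1 <= n < (M ^ 3).+1) f n.+1.
  rewrite big_nat_recl ?expn_gt0// /f !u1// subrr normr0 powR0// mul0r add0r.
  by [].
have gE : \sum_(1 <= n < (M ^ 3).+1) g n.+1 <= \sum_(1 <= n < (M ^ 3).+2) g n.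
  by rewrite [leRHS]big_nat_recl ?expn_gt0// lerDr.
(* Its increments dominate the errors: ln(n+1) - ln n >= 1/(n+1) and 1/n - 1/(n+1) >= 1/(n+1)^2. *)
pose h (n : nat) : R := ln n%:R / L - n%:R^-1.
have fg n : (1 <= n)%N -> f n.+1 <= A * g n.+1 + Q * (h n.+1 - h n).
  move=> n1; have x2 : 2 <= n.+1%:R :> R by rewrite ler_nat.
  have := step L n.+1%:R _ L1 x2 erefl.
  rewrite -{2}(@natr1 _ n) addrK => /le_trans; apply.
  rewrite lerD2l ler_wpM2l//.
  have x1 : 1 < n.+1%:R :> R by rewrite ltr1n.
  have nE : n.+1%:R - 1 = n%:R :> R by rewrite -natr1 addrK.
  have n0 : 0 < n%:R :> R by rewrite ltr0n.
  have /andP[hl _] := ln_step x1; rewrite nE in hl.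
  have Li : 0 <= L^-1 by rewrite invr_ge0 ltW.
  have := ler_wpM2r Li hl; rewrite /h mulrBl.
  have : (n.+1%:R : R) ^- 2 <= n%:R^-1 - n.+1%:R^-1.
    have -> : n%:R^-1 - n.+1%:R^-1 = (n%:R * n.+1%:R)^-1 :> R.
      by rewrite -natr1; field; rewrite !gt_eqF//; lra.
    rewrite lef_pV2 ?posrE ?exprn_gt0 ?mulr_gt0//; lra.
  move: ((n.+1%:R : R) ^- 2) ((n.+1%:R : R)^-1) ((n%:R : R)^-1) (ln (n.+1%:R : R)) (ln (n%:R : R)) (L^-1) => a b c d e k.
  by clear; lra.
(* The endpoints contribute at most (L + 1)/L from the logarithm and 1 from h(1) = -1, and L >=
   1. *)
have hsum : \sum_(1 <= n < (M ^ 3).+1) (h n.+1 - h n) <= 3.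
  rewrite telescope_sumr ?expn_gt0// /h ln1 mul0r invr1 sub0r opprK.
  have : ln ((M ^ 3).+1%:R : R) <= L + 1.
    have x1 : 1 < (M ^ 3).+1%:R :> R by rewrite ltr1n ltnS expn_gt0.
    have /andP[_] := ln_step x1; rewrite -natr1 addrK -LE expRK.
    have : (expR L)^-1 <= 1 by rewrite invf_le1 ?expR_gt0// -[leLHS]expR0 ler_expR ltW.
    lra.
  rewrite -(@ler_pM2r _ L^-1) ?invr_gt0// mulrDl divff ?gt_eqF// mul1r.
  have : L^-1 <= 1 by rewrite invf_le1.
  have : 0 <= ((M ^ 3).+1%:R : R)^-1 by rewrite invr_ge0.
  by move: (((M ^ 3).+1%:R : R)^-1) (ln ((M ^ 3).+1%:R : R) / L) (L^-1) => a b c; clear; lra.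
have upper : (C - A) * \sum_(1 <= n < (M ^ 3).+2) g n <= 3 * Q.
  rewrite mulrBl lerBlDl; apply: (le_trans hfg); rewrite fE.
  apply: (@le_trans _ _ (\sum_(1 <= n < (M ^ 3).+1) (A * g n.+1 + Q * (h n.+1 - h n)))).
    by apply: ler_sum_nat => n /andP[n1 _]; exact: fg.
  rewrite big_split/= -!mulr_sumr; apply: lerD; first by rewrite ler_wpM2l ?powR_ge0.
  by rewrite (mulrC 3) ler_wpM2l.
have M2 : (M <= M ^ 2)%N by rewrite -{1}(expn1 M) leq_pexp2l.
have M23 : (M ^ 2 <= (M ^ 3).+2)%N.
  by apply: (@leq_trans (M ^ 3)); [rewrite leq_pexp2l|by rewrite (leq_trans (leqnSn _))].
(* For M <= n < M^2 the potential term is at least c0 / n >= c0 (ln(n+1) - ln n), which telescopes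
   to c0 (ln M^2 - ln M) = c0 l. *)
have lower : c0 * l <= \sum_(1 <= n < (M ^ 3).+2) g n.
  rewrite (big_cat_nat M0 (leq_trans M2 M23))/= (big_cat_nat M2 M23)/=.
  rewrite -[leLHS]add0r; apply: lerD; first by apply: sumr_ge0.
  rewrite -[leLHS]addr0; apply: lerD; last by apply: sumr_ge0.
  have -> : l = \sum_(M <= n < M ^ 2) (ln (n.+1%:R : R) - ln n%:R).
    by rewrite telescope_sumr// natrX lnXn// mulr2n addrK.
  rewrite mulr_sumr; apply: ler_sum_nat => n /andP[nM nM2].
  have n0 : 0 < n%:R :> R by rewrite ltr0n (leq_trans M0).
  rewrite /g /u log_bump_weight// mulrC; apply: ler_pM; first by rewrite subr_ge0 ler_ln ?posrE// ler_nat.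
  - exact: ltW.
  - have x1 : 1 < n.+1%:R :> R by rewrite ltr1n ltnS -(@ltr0n R).
    by have /andP[_] := ln_step x1; rewrite -natr1 addrK.
  - rewrite ge0_ler_powR ?nnegrE ?expR_ge0 ?profile_ge0 ?(ltW p0)//.
    have h1 : l <= ln (n%:R : R) by rewrite ler_ln ?posrE// ler_nat.
    have h2 : ln (n%:R : R) <= 2 * l.
      rewrite mulr_natl -lnXn// ler_ln ?posrE ?exprn_gt0// -natrX ler_nat ltnW//.
    by apply: profile_ge; [rewrite ler_pdivlMr|rewrite ler_pdivrMr]; rewrite // /L; lra.
have : (C - A) * (c0 * X) <= 3 * Q.
  apply: le_trans upper; rewrite ler_pM2l//; apply: le_trans lower.
  by rewrite ler_pM2l.
by rewrite leNgt QX.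
Qed.

Unset Implicit Arguments.

Theorem theorem4p6 (R : realType) (p alpha : R)
  (hp : 1 < p) (halpha : 0 <= alpha) (hne : alpha != p - 1) :
  let Adisc := `|(alpha - p + 1) / p| `^ p in
  [/\ discrete_hardy alpha p Adisc,
      forall C : R, Adisc < C -> ~ discrete_hardy alpha p C &
      largest [set C | continuous_hardy alpha p C] Adisc].
Proof.
move=> Adisc; split.
- exact: discrete_hardy_Adisc.
- by move=> C ltC /(discrete_hardy_sharp hp halpha); rewrite leNgt ltC.
- split; first exact: continuous_hardy_Adisc.
  by move=> C; exact: continuous_hardy_sharp.
Qed.
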